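(* Suppose the bistatic ISAC channel is such that $(X,S)-Y-Z$ forms a Markov chain, i.e. $p(y,z|x,s)=p(y|x,s)\,p(z|y)$. Then for every $D\ge D_{\min}$ the capacity-distortion function satisfies $$C(D)=\max_{P_{UX}}\Big\{ I(X;Y\mid U,S)+I(U;Z)\ \Big|\ \mathbb E\big[d\big(S,\hat s^*(U,Z)\big)\big]\le D\Big\},$$ where the maximum is over pmfs $P_{UX}$ on $\mathcal U\times\mathcal X$, the cardinality of the auxiliary random variable $U$ satisfies $|\mathcal U|\le|\mathcal X|+1$, the joint distribution of $(S,U,X,Y,Z)$ is $P_{UX}P_SP_{YZ|XS}$, and $$\hat s^*(u,z)=\arg\min_{s'\in\hat{\mathcal S}}\sum_{s\in\mathcal S}P_{S|UZ}(s|u,z)\,d(s,s')$$ (ties broken arbitrarily).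
   Context: Bistatic ISAC model. $\mathcal X,\mathcal S,\mathcal Y,\mathcal Z,\hat{\mathcal S}$ are finite sets, $P_S$ is a pmf on $\mathcal S$, $P_{YZ|XS}=p(y,z|x,s)$ is a conditional pmf on $\mathcal Y\times\mathcal Z$ given $(x,s)\in\mathcal X\times\mathcal S$, and $d:\mathcal S\times\hat{\mathcal S}\to\mathbb R_+$ is a (bounded) distortion function. The state sequence $S^n$ is i.i.d. $\sim P_S$ and independent of the message; the channel is memoryless: given $(x^n,s^n)$, $(Y^n,Z^n)$ has pmf $\prod_i p(y_i,z_i|x_i,s_i)$ (no feedback). The communication receiver observes $Y^n$ and knows $S^n$ (noncausally); the sensing receiver observes only $Z^n$ (it knows the codebook but not the message). A $(2^{nR},n)$ code consists of a message set $[1:2^{nR}]=\{1,\dots,\lceil 2^{nR}\rceil\}$, an encoder $w\mapsto x^n(w)\in\mathcal X^n$, a decoder $(y^n,s^n)\mapsto\hat w$, and a state estimator $h:\mathcal Z^n\to\hat{\mathcal S}^n$, $\hat S^n=h(Z^n)$. The message $W$ is uniform on the message set. $P_e^{(n)}=\Pr\{\hat W\ne W\}$ and $D^{(n)}=\frac1n\sum_{i=1}^n\mathbb E[d(S_i,\hat S_i)]$. A pair $(R,D)$ is achievable if there is a sequence of $(2^{nR},n)$ codes with $\lim_n P_e^{(n)}=0$ and $\limsup_n D^{(n)}\le D$. The capacity-distortion function is $C(D)=\max\{R\ge 0:(R,D)\text{ achievable}\}$. $D_{\min}$ is the minimum of $\mathbb E[d(S,\hat s(Z))]$ over all pmfs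 $P_X$ on $\mathcal X$ and all maps $\hat s:\mathcal Z\to\hat{\mathcal S}$, with $(X,S,Y,Z)\sim P_XP_SP_{YZ|XS}$. Information quantities are in bits.
   Formalization: C(D) is taken as the supremum, not the maximum, of the achievable rates: with exactly ⌈2^{nR}⌉ messages the extremal rate need not be achievable (e.g. a binary symmetric channel at capacity), so the maximum may not exist. X and Ŝ are assumed nonempty. *)

(* Defs.v *)
(* Everything is finite: a pmf on a finType T is a function T -> R, and a
   random variable is a function on the sample space. *)
From HB Require Import structures.
From mathcomp Require Import all_boot all_order all_algebra.
From mathcomp Require Import boolp classical_sets reals ereal topology.
From mathcomp Require Import normedtype sequences exp.

Set Implicit Arguments.
Unset Strict Implicit.
Unset Printing Implicit Defensive.

Import Order.TTheory GRing.Theory Num.Theory.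
Import numFieldNormedType.Exports.

Local Open Scope classical_set_scope.
Local Open Scope ring_scope.

Section FiniteProbability.
Context {R : realType}.

Definition is_pmf (T : finType) (P : T -> R) : Prop :=
  (forall t, 0 <= P t) /\ \sum_t P t = 1.

Definition prob (T : finType) (P : T -> R) (E : pred T) : R :=
  \sum_(t | E t) P t.

Definition expect (T : finType) (P : T -> R) (f : T -> R) : R :=
  \sum_t P t * f t.

Definition law (T A : finType) (P : T -> R) (f : T -> A) (a : A) : R :=
  prob P (fun t => f t == a).

Definition rvpair (T A B : Type) (f : T -> A) (g : T -> B) (t : T) : A * B :=
  (f t, g t).

Definition log2 (x : R) : R := ln x / ln 2.

(* In both quantities below, terms of probability zero vanish because of the
   leading factor, which is the convention 0 log (0/0) = 0. *)

Definition mutual_info (T A B : finType) (P : T -> R) (f : T -> A)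
    (g : T -> B) : R :=
  \sum_a \sum_b
    let pab := law P (rvpair f g) (a, b) in
    pab * log2 (pab / (law P f a * law P g b)).

Definition cond_mutual_info (T A B C : finType) (P : T -> R) (f : T -> A)
    (g : T -> B) (h : T -> C) : R :=
  \sum_c \sum_a \sum_b
    let pabc := law P (rvpair (rvpair f g) h) (a, b, c) in
    pabc * log2 ((pabc * law P h c)
                 / (law P (rvpair f h) (a, c) * law P (rvpair g h) (b, c))).

Definition is_maximum (A : set R) (m : R) : Prop := A m /\ ubound A m.

End FiniteProbability.

(* [chan (x, s) (y, z)] is p(y, z | x, s). *)
Record bistatic (R : realType) (X S Y Z Shat : finType) := Bistatic {
  PS : S -> R;
  chan : X * S -> Y * Z -> R;
  dist : S -> Shat -> R;
  PS_pmf : is_pmf PS;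
  chan_pmf : forall xs, is_pmf (chan xs);
  dist_ge0 : forall s t, 0 <= dist s t
}.

(* Decoder and estimator see the whole blocks; the estimator may depend on the
   encoder but not on the message. *)
Record code (X S Y Z Shat : finType) (m n : nat) := Code {
  encoder : 'I_m -> {ffun 'I_n -> X};
  decoder : {ffun 'I_n -> Y} -> {ffun 'I_n -> S} -> 'I_m;
  estimator : {ffun 'I_n -> Z} -> {ffun 'I_n -> Shat}
}.

Section CapacityDistortion.
Context {R : realType} {X S Y Z Shat : finType}.
Implicit Type M : bistatic R X S Y Z Shat.

(* Law of (W, S^n, Y^n, Z^n). *)
Definition block_law M (m n : nat) (c : code X S Y Z Shat m n) :
    'I_m * {ffun 'I_n -> S} * {ffun 'I_n -> Y} * {ffun 'I_n -> Z} -> R :=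
  fun '(w, s, y, z) =>
    m%:R^-1 * (\prod_(i < n) PS M (s i))
    * \prod_(i < n) chan M (encoder c w i, s i) (y i, z i).

Definition error_prob M (m n : nat) (c : code X S Y Z Shat m n) : R :=
  prob (block_law M c) (fun '(w, s, y, z) => decoder c y s != w).

(* For n = 0 this is 0; only the limit in n matters. *)
Definition distortion M (m n : nat) (c : code X S Y Z Shat m n) : R :=
  n%:R^-1 * \sum_(i < n)
    expect (block_law M c) (fun '(w, s, y, z) => dist M (s i) (estimator c z i)).

Definition msg_card (r : R) (n : nat) : nat :=
  `|Num.ceil (2 `^ (n%:R * r))|%N.

Definition achievable M (r D : R) : Prop :=
  exists c : forall n, code X S Y Z Shat (msg_card r n) n,
    error_prob M (c n) @[n --> \oo] --> (0 : R) /\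
    (limn_esup (fun n => (distortion M (c n))%:E) <= D%:E)%E.

(* The supremum, not a maximum: with exactly ceil(2^(nR)) messages the extremal
   rate itself is in general not achievable (already for a binary symmetric
   channel).  Extended-real valued, so that no default value intervenes. *)
Definition capacity_distortion M (D : R) : \bar R :=
  ereal_sup [set r%:E | r in [set r : R | 0 <= r /\ achievable M r D]].

(* The infimum is a minimum as soon as X and Shat are nonempty. *)
Definition Dmin M : R :=
  inf [set v : R | exists (PX : X -> R) (h : Z -> Shat), is_pmf PX /\
    v = expect (fun '(x, s, y, z) => PX x * PS M s * chan M (x, s) (y, z))
               (fun '(x, s, y, z) => dist M s (h z))].

(* (X,S) - Y - Z: p(y, z | x, s) = p(y | x, s) p(z | y). *)
Definition markov_XS_Y_Z M : Prop :=
  exists Q : Y -> Z -> R, (forall y, is_pmf (Q y)) /\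
    forall x s y z,
      chan M (x, s) (y, z) = (\sum_z' chan M (x, s) (y, z')) * Q y z.

Section Auxiliary.
Context {U : finType}.

Definition joint_law M (P : U * X -> R) : S * U * X * Y * Z -> R :=
  fun '(s, u, x, y, z) => P (u, x) * PS M s * chan M (x, s) (y, z).

Definition rvS : S * U * X * Y * Z -> S := fun '(s, u, x, y, z) => s.
Definition rvU : S * U * X * Y * Z -> U := fun '(s, u, x, y, z) => u.
Definition rvX : S * U * X * Y * Z -> X := fun '(s, u, x, y, z) => x.
Definition rvY : S * U * X * Y * Z -> Y := fun '(s, u, x, y, z) => y.
Definition rvZ : S * U * X * Y * Z -> Z := fun '(s, u, x, y, z) => z.

(* P_{S|UZ}(s|u,z); equal to 0 when P_{UZ}(u,z) = 0, in which case every
   estimate is optimal at (u, z). *)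
Definition posterior M (P : U * X -> R) (u : U) (z : Z) (s : S) : R :=
  law (joint_law M P) (rvpair rvS (rvpair rvU rvZ)) (s, (u, z))
  / law (joint_law M P) (rvpair rvU rvZ) (u, z).

Definition is_argmin_estimator M (P : U * X -> R) (h : U -> Z -> Shat) : Prop :=
  forall u z t,
    \sum_s posterior M P u z s * dist M s (h u z)
      <= \sum_s posterior M P u z s * dist M s t.

Definition aux_distortion M (P : U * X -> R) (h : U -> Z -> Shat) : R :=
  expect (joint_law M P) (fun o => dist M (rvS o) (h (rvU o) (rvZ o))).

Definition aux_rate M (P : U * X -> R) : R :=
  cond_mutual_info (joint_law M P) rvX rvY (rvpair rvU rvS)
  + mutual_info (joint_law M P) rvU rvZ.

End Auxiliary.

(* [hstar U P] is the estimator used for the auxiliary pmf P on U * X. *)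
Definition aux_rates M
    (hstar : forall U : finType, (U * X -> R) -> U -> Z -> Shat) (D : R) :
    set R :=
  [set v : R | exists (U : finType) (P : U * X -> R),
    [/\ (#|U| <= #|X| + 1)%N, is_pmf P,
        aux_distortion M P (hstar U P) <= D & v = aux_rate M P]].

End CapacityDistortion.

(* Main.v *)
(* Write A = p(y|x,s), B = p(y|u,s), C = p(z|u).  The rate
   I(X;Y|U,S) + I(U;Z) is the mean of ln (A C / (B p(z))).

   Converse: take U_i = (i, Z^n without its i-th letter) with i uniform.
   Comparing the law of (W, S^n, Y^n, Z^n), by
   the Gibbs inequality, with
     q(w|y,s) prod_i PS(s_i) p(z_i|y_i) B(y_i|u_i,s_i) p(z_i) / C(z_i|u_i),
   q being a guess of the message centred at the decoder output, gives Fano's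
   inequality and the single-letter bound at once: the test law has mass at most
   1 because S_i is independent of U_i, so that summing over s_i and y_i
   reproduces C(z_i|u_i).

   Cardinality and closure: given P_X, rate and distortion are linear in the
   weights of the letters of U, so an optimal basic solution of the linear
   program uses at most |X| + 1 letters; with the alphabet of U fixed, the
   vanishing slack of the converse is removed by compactness of the simplex.

   Achievability: superposition coding with likelihood-ratio threshold decoders.
   The sensing receiver decodes the cloud center u^n from z^n; the communication
   receiver tests x^n against both u^n and the mixture, and degradedness gives
   I(U,X;Y|S) >= I(X;Y|U,S) + I(U;Z). *)

Require Import Defs.
From HB Require Import structures.
From mathcomp Require Import all_boot all_order all_algebra.
From mathcomp Require Import boolp classical_sets reals ereal topology.
From mathcomp Require Import normedtype sequences exp.
From mathcomp Require Import realfun derive.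
From mathcomp Require Import ring lra.

Set Implicit Arguments.
Unset Strict Implicit.
Unset Printing Implicit Defensive.

Import Order.TTheory GRing.Theory Num.Theory.
Import numFieldNormedType.Exports.

Local Open Scope ring_scope.

(** The estimator stays a free variable until the end: the optimum is taken over pairs of a pmf and
    an arbitrary map [U -> Z -> Shat], and [hstar] enters only by doing at least as well. For a
    fixed map the distortion is linear in the pmf, which the linear program and the compactness
    argument both use, and for a fixed alphabet of U there are finitely many maps. The converse
    yields an alphabet that grows with the block length, so its letters are reduced before any limit
    is taken. Random coding is carried out once, for a single use of a channel with an abstract
    cost; the n-fold product channel is an instance. All failure and collision probabilities are of
    order [sigma ^+ (2 * n)], so weighting the error by [sigma ^- n] gives one codebook whose error
    and excess distortion are both of order [sigma ^+ n]. Rates below the optimum are thus reached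
    at the same D, without relaxing it. Logarithms are natural inside the proof. Since [ln 0] and
    [0^-1] are both 0, identities between logarithms are proved only where the joint law is
    positive. *)

(** * Finite sums, product laws and the Gibbs inequality *)

Section FiniteSums.
Context {R : realType}.

Lemma sum_prod_ffun (I T : finType) (F : I -> T -> R) :
  \sum_(f : {ffun I -> T}) \prod_i F i (f i) = \prod_i \sum_t F i t.
Proof. by rewrite bigA_distr_bigA. Qed.

Lemma sum_delta (T : finType) (a : T) (F : T -> R) :
  \sum_t (t == a)%:R * F t = F a.
Proof.
rewrite (bigD1 a) //= eqxx mul1r big1 ?addr0 // => t /negbTE ->.
by rewrite mul0r.
Qed.

Lemma sum_deltar (T : finType) (a : T) (F : T -> R) :
  \sum_t F t * (t == a)%:R = F a.
Proof. by under eq_bigr do rewrite mulrC; rewrite sum_delta. Qed.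

Lemma sum_pair (A B : finType) (F : A * B -> R) :
  \sum_t F t = \sum_a \sum_b F (a, b).
Proof. by rewrite pair_bigA; apply: eq_bigr => -[]. Qed.

Lemma sum_ffun_pair (I T1 T2 : finType) (F : {ffun I -> T1} -> {ffun I -> T2} -> R) :
  \sum_f \sum_g F f g
  = \sum_(h : {ffun I -> T1 * T2}) F [ffun i => (h i).1] [ffun i => (h i).2].
Proof.
rewrite pair_bigA /=.
rewrite (reindex (fun h : {ffun I -> T1 * T2} =>
  ([ffun i => (h i).1], [ffun i => (h i).2]))) //=.
exists (fun fg : {ffun I -> T1} * {ffun I -> T2} => [ffun i => (fg.1 i, fg.2 i)]).
- by move=> h _; apply/ffunP => i; rewrite !ffunE /=; case: (h i).
- by move=> [f g] _ /=; congr pair; apply/ffunP => i; rewrite !ffunE.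
Qed.

(** Pinning the two coordinates with indicators turns the summand into a product over [k], to which
    [sum_prod_ffun] applies; all other factors sum to 1. *)
Lemma sum_ffun2 (I T : finType) (P : I -> T -> R) (i j : I) (phi : T -> T -> R) :
  (forall k, \sum_t P k t = 1) -> i != j ->
  \sum_(f : {ffun I -> T}) (\prod_k P k (f k)) * phi (f i) (f j)
  = \sum_a \sum_b P i a * (P j b * phi a b).
Proof.
move=> P1 ij.
pose F a b k t := P k t * (if k == i then (t == a)%:R else
  if k == j then (t == b)%:R else 1).
have E (f : {ffun I -> T}) :
  (\prod_k P k (f k)) * phi (f i) (f j)
   = \sum_a \sum_b (\prod_k F a b k (f k)) * phi a b.
  transitivity (\sum_a (a == f i)%:R * \sum_b (b == f j)%:R
      * ((\prod_k P k (f k)) * phi a b)); first by rewrite !sum_delta.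
  apply: eq_bigr => a _; rewrite mulr_sumr; apply: eq_bigr => b _.
  suff -> : \prod_k F a b k (f k)
    = (\prod_k P k (f k)) * ((f i == a)%:R * (f j == b)%:R).
    by rewrite (eq_sym a) (eq_sym b); ring.
  rewrite big_split /=; congr (_ * _).
  rewrite (bigD1 i) //= (bigD1 j) 1?eq_sym //= [j == i]eq_sym !eqxx (negbTE ij).
  by rewrite big1 ?mulr1 // => k /andP[/negbTE -> /negbTE ->].
under eq_bigr => f _ do rewrite E.
rewrite exchange_big /=; apply: eq_bigr => a _.
rewrite exchange_big /=; apply: eq_bigr => b _.
rewrite -mulr_suml sum_prod_ffun (bigD1 i) //= (bigD1 j) 1?eq_sym //=.
rewrite [X in _ * (_ * X)]big1 ?mulr1 => [|k /andP[ki kj]]; last first.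
  rewrite -(P1 k) /F; apply: eq_bigr => t _.
  by rewrite (negbTE ki) (negbTE kj) mulr1.
rewrite /F [j == i]eq_sym !eqxx (negbTE ij) mulrA.
by rewrite !sum_deltar.
Qed.

Lemma sum_ffun1 (I T : finType) (P : I -> T -> R) (i : I) (phi : T -> R) :
  (forall k, \sum_t P k t = 1) ->
  \sum_(f : {ffun I -> T}) (\prod_k P k (f k)) * phi (f i)
  = \sum_a P i a * phi a.
Proof.
move=> P1.
pose F k t := P k t * (if k == i then phi t else 1).
transitivity (\sum_(f : {ffun I -> T}) \prod_k F k (f k)).
  apply: eq_bigr => f _; rewrite big_split /=; congr (_ * _).
  by rewrite (bigD1 i) //= eqxx big1 ?mulr1 // => k /negbTE ->.
rewrite sum_prod_ffun (bigD1 i) //= [X in _ * X]big1 ?mulr1.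
  by apply: eq_bigr => a _; rewrite /F eqxx.
by move=> k /negbTE ki; rewrite -(P1 k) /F; apply: eq_bigr => t _; rewrite ki mulr1.
Qed.

(** Termwise from [ln x <= x - 1] at [x = r t / p t]. The support condition is explicit because
    [ln 0] is 0, so that a zero of [r] would not send the left side to minus infinity. *)
Lemma gibbs (T : finType) (p r : T -> R) :
  is_pmf p -> (forall t, 0 <= r t) -> (forall t, 0 < p t -> 0 < r t) ->
  \sum_t r t <= 1 ->
  \sum_t p t * (ln (r t) - ln (p t)) <= 0.
Proof.
move=> [p0 p1] r0 rgt0 r1.
apply: (@le_trans _ _ (\sum_t (r t - p t))); last by rewrite sumrB p1 subr_le0.
apply: ler_sum => t _.
have [pt0|pt] := eqVneq (p t) 0; first by rewrite pt0 mul0r subr0.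
have {}pt : 0 < p t by rewrite lt_neqAle eq_sym pt p0.
have rt := rgt0 _ pt.
rewrite -ln_div // mulrC -ler_pdivlMr // mulrBl divff ?gt_eqF //.
rewrite -{1}(subrK 1 (r t / p t)) addrC.
by apply: le_ln1Dx; rewrite ltrBrDl subrr divr_gt0.
Qed.

Lemma ln_prod (I : finType) (F : I -> R) : (forall i, 0 < F i) ->
  ln (\prod_i F i) = \sum_i ln (F i).
Proof.
move=> F0.
suff [] : 0 < \prod_i F i /\ ln (\prod_i F i) = \sum_i ln (F i) by [].
apply: (big_ind2 (fun a b => 0 < a /\ ln a = b)) => //; first by rewrite ln1.
by move=> a1 b1 a2 b2 [a10 <-] [a20 <-]; rewrite mulr_gt0 // lnM.
Qed.

Lemma sum_pick (T : finType) (a : T) (F : T -> R) :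
  (forall t, t != a -> F t = 0) -> \sum_t F t = F a.
Proof. by move=> F0; rewrite (bigD1 a) //= big1 ?addr0. Qed.

Lemma sum_gt0 (T : finType) (F : T -> R) a :
  (forall t, 0 <= F t) -> 0 < F a -> 0 < \sum_t F t.
Proof.
by move=> F0 Fa; rewrite (bigD1 a) //= ltr_wpDr // sumr_ge0.
Qed.

Lemma mulr_gt0_split (a b : R) : 0 <= a -> 0 <= b -> 0 < a * b -> 0 < a /\ 0 < b.
Proof.
move=> a0 b0 ab; rewrite !lt_neqAle a0 b0 !andbT !(eq_sym 0).
by split; apply: contraTneq ab => ->; rewrite ?mul0r ?mulr0 ltxx.
Qed.

Lemma ln2_gt0 : 0 < ln 2 :> R.
Proof. by rewrite ln_gt0 ?ltr1n. Qed.

Lemma sum_law (T A : finType) (Q : T -> R) (f : T -> A) (F : A -> R) :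
  \sum_a law Q f a * F a = \sum_t Q t * F (f t).
Proof.
rewrite (partition_big f xpredT) //=; apply: eq_bigr => a _.
by rewrite /law /prob mulr_suml; apply: eq_bigr => t /eqP ->.
Qed.

Lemma prod_eq_ffun (I : finType) (T : eqType) (f g : {ffun I -> T}) :
  \prod_j (f j == g j)%:R = (f == g)%:R :> R.
Proof.
have [->|fg] := eqVneq f g; first by rewrite big1 // => j _; rewrite eqxx.
suff [j jfg] : exists j, f j != g j by rewrite (bigD1 j) //= (negbTE jfg) mul0r.
apply: contrapT => H; move/eqP: fg; apply; apply/ffunP => j.
by apply/eqP; apply: contrapT => /negP ?; apply: H; exists j.
Qed.

Lemma prod_gt0 (I : finType) (F : I -> R) : (forall i, 0 <= F i) ->
  0 < \prod_i F i -> forall i, 0 < F i.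
Proof.
move=> F0 p i; rewrite lt_neqAle F0 andbT eq_sym.
by apply: contraTneq p => Fi; rewrite (bigD1 i) //= Fi mul0r ltxx.
Qed.

Lemma ind_le (b : bool) (c : R) : 0 <= c -> (b -> 1 <= c) -> b%:R <= c.
Proof. by case: b => // _; apply. Qed.

Lemma ind_ratio (b : bool) (g p q : R) : 0 < g -> 0 <= q -> (b -> g * p <= q) ->
  p * b%:R <= g^-1 * q.
Proof.
move=> g0 q0; case: b => [/(_ isT) pq|_]; last by rewrite mulr0 mulr_ge0 // invr_ge0 ltW.
by rewrite mulr1 ler_pdivlMl.
Qed.

Lemma average_const (T : finType) (v : T -> R) (F : T -> R) (b : R) :
  is_pmf v -> (forall a, F a <= b) -> \sum_a v a * F a <= b.
Proof.
move=> [v0 v1] Fb; rewrite -[leRHS]mul1r -v1 mulr_suml.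
by apply: ler_sum => a _; apply: ler_wpM2l.
Qed.

Lemma prod_pmf (I T : finType) (p : I -> T -> R) :
  (forall i, is_pmf (p i)) ->
  is_pmf (fun t : {ffun I -> T} => \prod_i p i (t i)).
Proof.
move=> pp; split=> [t|]; first by apply: prodr_ge0 => i _; case: (pp i).
by rewrite sum_prod_ffun big1 // => i _; case: (pp i).
Qed.

End FiniteSums.

(** * Mutual information as the mean of a log-ratio *)

Section Information.
Context {R : realType}.

Lemma mutual_info_expect (T A B : finType) (Q : T -> R) (f : T -> A)
    (g : T -> B) :
  mutual_info Q f g = \sum_t Q t *
    log2 (law Q (rvpair f g) (f t, g t) / (law Q f (f t) * law Q g (g t))).
Proof.
rewrite -(sum_law Q (rvpair f g) (fun ab =>
  log2 (law Q (rvpair f g) ab / (law Q f ab.1 * law Q g ab.2)))).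
by rewrite /mutual_info pair_bigA; apply: eq_bigr => -[].
Qed.

Lemma cond_mutual_info_expect (T A B C : finType) (Q : T -> R) (f : T -> A)
    (g : T -> B) (h : T -> C) :
  cond_mutual_info Q f g h = \sum_t Q t *
    log2 ((law Q (rvpair (rvpair f g) h) (f t, g t, h t) * law Q h (h t)) /
      (law Q (rvpair f h) (f t, h t) * law Q (rvpair g h) (g t, h t))).
Proof.
rewrite -(sum_law Q (rvpair (rvpair f g) h) (fun abc =>
  log2 ((law Q (rvpair (rvpair f g) h) abc * law Q h abc.2) /
      (law Q (rvpair f h) (abc.1.1, abc.2) * law Q (rvpair g h) (abc.1.2, abc.2))))).
rewrite /cond_mutual_info.
under eq_bigr do rewrite pair_bigA /=.
by rewrite exchange_big pair_bigA; apply: eq_bigr => -[[]].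
Qed.

End Information.

(** * Single-letter quantities *)

Section SingleLetter.
Context {R : realType} {X S Y Z Shat : finType} (M : bistatic R X S Y Z Shat).

(* p(y|x,s) and p(z|x). *)
Definition outY x s y : R := \sum_z chan M (x, s) (y, z).
Definition outZ x z : R := \sum_s \sum_y PS M s * chan M (x, s) (y, z).

Lemma chan_ge0 x s y z : 0 <= chan M (x, s) (y, z).
Proof. by have [] := chan_pmf M (x, s). Qed.

Lemma PS_ge0 s : 0 <= PS M s.
Proof. by have [] := PS_pmf M. Qed.

Lemma sum_PS : \sum_s PS M s = 1.
Proof. by have [] := PS_pmf M. Qed.

Lemma sum_chan x s : \sum_y \sum_z chan M (x, s) (y, z) = 1.
Proof.
by have [_ <-] := chan_pmf M (x, s); rewrite pair_bigA; apply: eq_bigr => -[].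
Qed.

Lemma outY_ge0 x s y : 0 <= outY x s y.
Proof. by apply: sumr_ge0 => z _; exact: chan_ge0. Qed.

Lemma outZ_ge0 x z : 0 <= outZ x z.
Proof.
by do 2 apply: sumr_ge0 => ? _; rewrite mulr_ge0 ?PS_ge0 ?chan_ge0.
Qed.

Lemma sum_outY x s : \sum_y outY x s y = 1.
Proof. exact: sum_chan. Qed.

Lemma sum_outZ x : \sum_z outZ x z = 1.
Proof.
rewrite /outZ exchange_big /= -[RHS]sum_PS; apply: eq_bigr => s _.
rewrite exchange_big /= -[RHS]mulr1 -(sum_chan x s) mulr_sumr.
by apply: eq_bigr => y _; rewrite mulr_sumr.
Qed.

Section Auxiliary.
Context {U : finType} (P : U * X -> R).

(* p(u), p(u,y|s), p(u,z) and p(z). *)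
Definition margU u := \sum_x P (u, x).
Definition jointY u s y := \sum_x P (u, x) * outY x s y.
Definition jointZ u z := \sum_x P (u, x) * outZ x z.
Definition margZ z := \sum_u jointZ u z.

(* On the support this is ln (p(y|x,s) / p(y|u,s)) + ln (p(z|u) / p(z)): the
   factors p(u) of [jointY] and [jointZ] cancel. *)
Definition info_density (o : S * U * X * Y * Z) : R :=
  let: (s, u, x, y, z) := o in
  ln (outY x s y) + ln (jointZ u z) - ln (jointY u s y) - ln (margZ z).

Lemma sum_joint (F : S * U * X * Y * Z -> R) :
  \sum_o F o = \sum_s \sum_u \sum_x \sum_y \sum_z F (s, u, x, y, z).
Proof. by rewrite !pair_bigA; apply: eq_bigr => -[[[[]]]]. Qed.

Lemma law_joint (A : finType) (f : S * U * X * Y * Z -> A) a :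
  law (joint_law M P) f a =
  \sum_s \sum_u \sum_x \sum_y \sum_z
    if f (s, u, x, y, z) == a then P (u, x) * PS M s * chan M (x, s) (y, z)
    else 0.
Proof. by rewrite /law /prob big_mkcond /= sum_joint. Qed.

(** Collapses the outermost sum to the index [a] that the event prescribes; every other term is
    0. *)
Ltac pick a :=
  rewrite (sum_pick (a := a)); last by
    let ne := fresh in move=> ? /negbTE ne; repeat (apply: big1 => ? _);
    rewrite /= /rvpair /= ?xpair_eqE ?ne ?andbF ?andFb.

Ltac unlaw := rewrite /= /rvpair /= ?eqxx.

Lemma law_XYUS s u x y :
  law (joint_law M P) (rvpair (rvpair rvX rvY) (rvpair rvU rvS)) (x, y, (u, s))
  = P (u, x) * PS M s * outY x s y.
Proof.
rewrite law_joint; pick s; pick u; pick x; pick y.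
by rewrite mulr_sumr; apply: eq_bigr => z _; unlaw.
Qed.

Lemma law_XUS s u x :
  law (joint_law M P) (rvpair rvX (rvpair rvU rvS)) (x, (u, s))
  = P (u, x) * PS M s.
Proof.
rewrite law_joint; pick s; pick u; pick x; unlaw.
transitivity (P (u, x) * PS M s * \sum_y outY x s y); last first.
  by rewrite sum_outY mulr1.
by rewrite mulr_sumr; apply: eq_bigr => y _; rewrite mulr_sumr.
Qed.

Lemma law_YUS s u y :
  law (joint_law M P) (rvpair rvY (rvpair rvU rvS)) (y, (u, s))
  = PS M s * jointY u s y.
Proof.
rewrite law_joint; pick s; pick u; rewrite mulr_sumr.
apply: eq_bigr => x _; pick y; unlaw.
by rewrite mulrA [_ * P _]mulrC mulr_sumr.
Qed.

Lemma law_US s u :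
  law (joint_law M P) (rvpair rvU rvS) (u, s) = PS M s * margU u.
Proof.
rewrite law_joint; pick s; pick u; unlaw; rewrite mulr_sumr.
apply: eq_bigr => x _; rewrite -[RHS]mulr1 -(sum_outY x s) mulr_sumr.
by apply: eq_bigr => y _; rewrite -mulr_sumr [PS M s * _]mulrC.
Qed.

Lemma law_SUZ s u z :
  law (joint_law M P) (rvpair rvS (rvpair rvU rvZ)) (s, (u, z))
  = \sum_x \sum_y P (u, x) * PS M s * chan M (x, s) (y, z).
Proof.
rewrite law_joint; pick s; pick u; apply: eq_bigr => x _.
by apply: eq_bigr => y _; pick z; unlaw.
Qed.

Lemma jointZ_sum u z :
  jointZ u z = \sum_s \sum_x \sum_y P (u, x) * PS M s * chan M (x, s) (y, z).
Proof.
rewrite exchange_big /=; apply: eq_bigr => x _; rewrite mulr_sumr.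
by apply: eq_bigr => s _; rewrite mulr_sumr; apply: eq_bigr => y _; rewrite mulrA.
Qed.

Lemma law_UZ u z : law (joint_law M P) (rvpair rvU rvZ) (u, z) = jointZ u z.
Proof.
rewrite jointZ_sum law_joint; apply: eq_bigr => s _; pick u.
by apply: eq_bigr => x _; apply: eq_bigr => y _; pick z; unlaw.
Qed.

Lemma law_Z z : law (joint_law M P) rvZ z = margZ z.
Proof.
transitivity (\sum_u law (joint_law M P) (rvpair rvU rvZ) (u, z)).
  rewrite law_joint exchange_big /=; apply: eq_bigr => u _.
  rewrite law_joint; apply: eq_bigr => s _; pick u.
  apply: eq_bigr => x _; apply: eq_bigr => y _; pick z.
  by pick z; unlaw.
by apply: eq_bigr => u _; rewrite law_UZ.
Qed.

Lemma law_U u : law (joint_law M P) rvU u = margU u.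
Proof.
transitivity (\sum_s law (joint_law M P) (rvpair rvU rvS) (u, s)).
  rewrite law_joint; apply: eq_bigr => s _; rewrite law_joint; pick u.
  pick s; pick u; apply: eq_bigr => x _; apply: eq_bigr => y _.
  by apply: eq_bigr => z _; unlaw.
under eq_bigr do rewrite law_US.
by rewrite -mulr_suml sum_PS mul1r.
Qed.

Lemma sum_margZ : is_pmf P -> \sum_z margZ z = 1.
Proof.
move=> [_ <-]; rewrite exchange_big sum_pair; apply: eq_bigr => u _.
rewrite exchange_big /=; apply: eq_bigr => x _.
by rewrite -mulr_sumr sum_outZ mulr1.
Qed.

(** The Markov chain enters here: S is independent of U, so summing P_S(s) p(u,y|s) p(z|y) over s
    and y gives p(u,z). The converse and the comparison of informations both rest on this sum. *)
Lemma jointZ_markov (Q : Y -> Z -> R) u z :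
  (forall x s y, chan M (x, s) (y, z) = outY x s y * Q y z) ->
  \sum_s \sum_y PS M s * Q y z * jointY u s y = jointZ u z.
Proof.
move=> markov; rewrite jointZ_sum; apply: eq_bigr => s _.
rewrite exchange_big /=; apply: eq_bigr => y _.
by rewrite mulr_sumr; apply: eq_bigr => x _; rewrite markov; ring.
Qed.

Hypothesis P_ge0 : forall u x, 0 <= P (u, x).

Lemma margU_ge0 u : 0 <= margU u.
Proof. by apply: sumr_ge0. Qed.

Lemma jointY_ge0 u s y : 0 <= jointY u s y.
Proof. by apply: sumr_ge0 => x _; rewrite mulr_ge0 ?outY_ge0. Qed.

Lemma jointZ_ge0 u z : 0 <= jointZ u z.
Proof. by apply: sumr_ge0 => x _; rewrite mulr_ge0 ?outZ_ge0. Qed.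

Lemma margZ_ge0 z : 0 <= margZ z.
Proof. by apply: sumr_ge0 => x _; exact: jointZ_ge0. Qed.

Lemma margU_gt0 u x : 0 < P (u, x) -> 0 < margU u.
Proof. by move=> ?; apply: (sum_gt0 (a := x)). Qed.

Lemma outY_gt0 x s y z : 0 < chan M (x, s) (y, z) -> 0 < outY x s y.
Proof. by move=> ?; apply: (sum_gt0 (a := z)) => // ?; exact: chan_ge0. Qed.

Lemma outZ_gt0 x s y z :
  0 < PS M s -> 0 < chan M (x, s) (y, z) -> 0 < outZ x z.
Proof.
have H s' y' : 0 <= PS M s' * chan M (x, s') (y', z).
  by rewrite mulr_ge0 ?PS_ge0 ?chan_ge0.
move=> ? ?; apply: (sum_gt0 (a := s)) => [?|]; first exact: sumr_ge0.
by apply: (sum_gt0 (a := y)) => //; rewrite mulr_gt0.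
Qed.

Lemma jointY_gt0 u x s y : 0 < P (u, x) -> 0 < outY x s y -> 0 < jointY u s y.
Proof.
move=> ? ?; apply: (sum_gt0 (a := x)); last by rewrite mulr_gt0.
by move=> ?; rewrite mulr_ge0 ?outY_ge0.
Qed.

Lemma jointZ_gt0 u x z : 0 < P (u, x) -> 0 < outZ x z -> 0 < jointZ u z.
Proof.
move=> ? ?; apply: (sum_gt0 (a := x)); last by rewrite mulr_gt0.
by move=> ?; rewrite mulr_ge0 ?outZ_ge0.
Qed.

Lemma margZ_gt0 u z : 0 < jointZ u z -> 0 < margZ z.
Proof. by move=> ?; apply: (sum_gt0 (a := u)) => // ?; exact: jointZ_ge0. Qed.

Lemma joint_gt0 s u x y z : 0 < joint_law M P (s, u, x, y, z) ->
  [/\ 0 < P (u, x), 0 < PS M s & 0 < chan M (x, s) (y, z)].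
Proof.
have P0 := P_ge0 u x; have S0 := PS_ge0 s; have c0 := chan_ge0 x s y z.
by move=> /mulr_gt0_split[]; rewrite ?mulr_ge0 // => /mulr_gt0_split[].
Qed.

Lemma joint_ge0 o : 0 <= joint_law M P o.
Proof. by case: o => [[[[s u] x] y] z]; rewrite !mulr_ge0 ?PS_ge0 ?chan_ge0. Qed.

Lemma aux_rate_density :
  aux_rate M P * ln 2 = \sum_o joint_law M P o * info_density o.
Proof.
rewrite /aux_rate mutual_info_expect cond_mutual_info_expect -big_split /=.
rewrite mulr_suml; apply: eq_bigr => -[[[[s u] x] y] z] _.
have [->|J0] := eqVneq (joint_law M P (s, u, x, y, z)) 0.
  by rewrite !mul0r addr0 mul0r.
have /joint_gt0[Pp Sp cp] : 0 < joint_law M P (s, u, x, y, z).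
  by rewrite lt_neqAle eq_sym J0 joint_ge0.
have Yp := outY_gt0 cp; have Zp := outZ_gt0 Sp cp.
have Up := margU_gt0 Pp; have JY := jointY_gt0 Pp Yp.
have JZ := jointZ_gt0 Pp Zp; have MZ := margZ_gt0 JZ.
rewrite -mulrDr -mulrA; congr (_ * _).
have -> : rvpair rvU rvS (s, u, x, y, z) = (u, s) by [].
rewrite /rvX /rvY /rvU /rvZ -/rvX -/rvY -/rvU -/rvZ.
rewrite law_XYUS law_US law_XUS law_YUS law_UZ law_U law_Z.
rewrite /log2 -mulrDl divfK ?gt_eqF ?ln2_gt0 //.
rewrite !(ln_div, lnM) ?posrE ?mulr_gt0 //=; ring.
Qed.

Lemma sum_joint_ch (F : S -> U -> X -> R) :
  \sum_o joint_law M P o * F (rvS o) (rvU o) (rvX o)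
  = \sum_s \sum_u \sum_x P (u, x) * PS M s * F s u x.
Proof.
rewrite sum_joint; do 3 apply: eq_bigr => ? _.
rewrite /=; under eq_bigr do rewrite -mulr_suml -mulr_sumr.
by rewrite -mulr_suml -mulr_sumr sum_chan mulr1.
Qed.

Lemma sum_joint_law : \sum_o joint_law M P o = \sum_ux P ux.
Proof.
rewrite -[LHS]mulr1 mulr_suml (sum_joint_ch (fun _ _ _ => 1)) sum_pair.
under eq_bigr => s _ do under eq_bigr => u _ do rewrite -mulr_suml -mulr_suml.
under eq_bigr => s _ do rewrite -mulr_suml -mulr_suml mulr1 mulrC.
by rewrite -mulr_suml sum_PS mul1r.
Qed.

Lemma joint_pmf : is_pmf P -> is_pmf (joint_law M P).
Proof. by move=> [_ P1]; split; [exact: joint_ge0|rewrite sum_joint_law]. Qed.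

(** The share of the letter [u] in the distortion. Being linear in the row of [u], it can serve as a
    constraint of the linear program. *)
Definition estimate_cost (h : U -> Z -> Shat) u :=
  \sum_x P (u, x) * \sum_s \sum_y \sum_z
    PS M s * chan M (x, s) (y, z) * dist M s (h u z).

Lemma aux_distortion_cost (h : U -> Z -> Shat) :
  aux_distortion M P h = \sum_u estimate_cost h u.
Proof.
rewrite /aux_distortion /expect sum_joint exchange_big /=.
apply: eq_bigr => u _; rewrite exchange_big /=; apply: eq_bigr => x _.
do 3 (rewrite mulr_sumr; apply: eq_bigr => ? _).
by rewrite !mulrA.
Qed.

(** The distortion is the mean over (u, z) of the posterior cost, so minimising each posterior cost
    minimises the whole. *)
Lemma argmin_estimator_le (h k : U -> Z -> Shat) : is_argmin_estimator M P h ->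
  aux_distortion M P h <= aux_distortion M P k.
Proof.
move=> hmin.
have E (g : U -> Z -> Shat) : aux_distortion M P g = \sum_u \sum_z
    jointZ u z * \sum_s posterior M P u z s * dist M s (g u z).
  transitivity (\sum_s \sum_u \sum_z
     law (joint_law M P) (rvpair rvS (rvpair rvU rvZ)) (s, (u, z))
       * dist M s (g u z)).
    rewrite /aux_distortion /expect sum_joint; do 2 apply: eq_bigr => ? _.
    rewrite /=; under eq_bigr do rewrite exchange_big /=.
    rewrite exchange_big /=; apply: eq_bigr => z _.
    rewrite law_SUZ mulr_suml; apply: eq_bigr => x _.
    by rewrite mulr_suml.
  rewrite exchange_big; apply: eq_bigr => u _.
  rewrite exchange_big; apply: eq_bigr => z _.
  rewrite mulr_sumr; apply: eq_bigr => s _.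
  rewrite /posterior law_UZ mulrA; congr (_ * _).
  (* [posterior] divides by [jointZ]; where that vanishes, so does the joint probability of (s, u,
     z). *)
  have [J0|J0] := eqVneq (jointZ u z) 0; last by rewrite mulrC divfK.
  rewrite J0 mul0r law_SUZ; move: s {J0}(J0); rewrite jointZ_sum => s.
  by move=> /psumr_eq0P-> // s' _; do 2 apply: sumr_ge0 => ? _;
    rewrite !mulr_ge0 ?PS_ge0 ?chan_ge0.
rewrite !E; apply: ler_sum => u _; apply: ler_sum => z _.
by apply: ler_wpM2l; [exact: jointZ_ge0|exact: hmin].
Qed.

End Auxiliary.
End SingleLetter.

(** * Cardinality of the auxiliary alphabet *)

Section SupportReduction.
Context {R : realType} {U I : finType} (a : U -> I -> R) (Q : pred I)
  (g : U -> R).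

(** The rows of [a] indexed by [A] form a matrix with more rows than columns, so its left kernel is
    not zero. *)
Lemma kernel_direction (A : {set U}) : (#|I| < #|A|)%N ->
  exists v : U -> R, [/\ exists u, v u != 0, forall u, v u != 0 -> u \in A &
    forall i, \sum_u v u * a u i = 0].
Proof.
move=> IA.
pose B : 'M[R]_(#|A|, #|I|) := \matrix_(k, i) a (enum_val k) (enum_val i).
have /matrix0Pn [r [c Krc]] : kermx B != 0.
  by rewrite -mxrank_eq0 mxrank_ker -lt0n subn_gt0 (leq_ltn_trans (rank_leq_col B)).
pose v u := \sum_k kermx B r k * (u == enum_val k)%:R.
have sumv (F : U -> R) : \sum_u v u * F u = \sum_k kermx B r k * F (enum_val k).
  under eq_bigr do rewrite mulr_suml.
  rewrite exchange_big /=; apply: eq_bigr => k _.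
  under eq_bigr do rewrite -mulrA.
  by rewrite -mulr_sumr sum_delta.
exists v; split.
- exists (enum_val c); rewrite /v.
  under eq_bigr do rewrite (inj_eq enum_val_inj) eq_sym.
  by rewrite sum_deltar.
- move=> u; apply: contraR => uA; apply/eqP/big1 => k _.
  by rewrite (_ : _ == _ = false) ?mulr0 //; apply: contraNF uA => /eqP ->; exact: enum_valP.
- move=> i; rewrite sumv.
  have /matrixP/(_ r (enum_rank i)) := mulmx_ker B.
  rewrite !mxE => E; rewrite -[RHS]E; apply: eq_bigr => k _.
  by rewrite [B k _]mxE enum_rankK.
Qed.

Hypothesis a_pos : forall u, 0 <= \sum_(i | Q i) a u i.

(* A basic feasible solution of the linear program "maximise sum w g subject to
   the #|I| equality constraints" has at most #|I| nonzero weights. *)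
Lemma support_reduction (w : U -> R) : (forall u, 0 <= w u) ->
    (forall u, w u != 0 -> 0 < \sum_(i | Q i) a u i) ->
  exists w' : U -> R, [/\ forall u, 0 <= w' u,
    forall i, \sum_u w' u * a u i = \sum_u w u * a u i,
    \sum_u w u * g u <= \sum_u w' u * g u &
    (#|[set u | w' u != 0%R]| <= #|I|)%N].
Proof.
have [m] := ubnP #|[set u | w u != 0]|.
elim: m w => // m IH w; rewrite ltnS => wm w0 wpos.
have [small|big] := leqP #|[set u | w u != 0]| #|I|; first by exists w.
have [v [vn0 vA vker]] := kernel_direction big.
(* The opposite of a kernel vector is again one, so the objective may be assumed not to decrease
   along [v]. *)
wlog vg : v vn0 vA vker / 0 <= \sum_u v u * g u.
  move=> H; have [|vg] := leP 0 (\sum_u v u * g u); first exact: H.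
  apply: (H (fun u => - v u)).
  - by case: vn0 => u; exists u; rewrite oppr_eq0.
  - by move=> u; rewrite oppr_eq0; exact: vA.
  - move=> i; under eq_bigr do rewrite mulNr.
    by rewrite sumrN vker oppr0.
  - under eq_bigr do rewrite mulNr.
    by rewrite sumrN oppr_ge0 ltW.
(* Were [v] nonnegative, its pairing with the row sums over [Q], positive on the support of [w],
   would be positive; the kernel equations make it 0. *)
have [u0 u0neg] : exists u, v u < 0.
  apply: contrapT => nneg.
  have v0 u : 0 <= v u by rewrite leNgt; apply/negP => ?; apply: nneg; exists u.
  have : \sum_u v u * \sum_(i | Q i) a u i = 0.
    under eq_bigr do rewrite mulr_sumr.
    by rewrite exchange_big big1 //= => i _; rewrite vker.
  move=> /psumr_eq0P H; case: vn0 => u vu.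
  have uw := wpos u; have := vA u vu; rewrite inE => /uw.
  apply/negP; rewrite -leNgt.
  have /eqP : v u * \sum_(i | Q i) a u i = 0 by apply: H => // *; rewrite mulr_ge0.
  by rewrite mulf_eq0 (negbTE vu) /= => /eqP ->.
pose f u := w u / - v u.
case: (@Order.TotalTheory.arg_minP _ _ _ u0 (fun u => v u < 0) f u0neg) => u1 u1neg u1min.
(* The longest step along [v] that keeps all weights nonnegative; it brings the weight of [u1] to
   0. *)
pose t := f u1.
have t0 : 0 <= t by rewrite divr_ge0 // oppr_ge0 ltW.
pose w1 u := w u + t * v u.
have w1lin (F : U -> R) : \sum_u w1 u * F u = \sum_u w u * F u + t * \sum_u v u * F u.
  by rewrite mulr_sumr -big_split /=; apply: eq_bigr => u _; rewrite /w1; ring.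
have w1sub u : w1 u != 0 -> w u != 0.
  apply: contraNneq => wu; rewrite /w1 wu add0r mulf_eq0.
  have [_|/vA] := eqVneq (v u) 0; first by rewrite orbT.
  by rewrite inE wu eqxx.
case: (IH w1).
- apply: leq_trans wm; apply: proper_card; apply/properP; split.
    by apply/fintype.subsetP => u; rewrite !inE; exact: w1sub.
  exists u1; rewrite !inE.
    by have := vA u1 (ltr0_neq0 u1neg); rewrite inE.
  by rewrite negbK /w1 /t /f; apply/eqP; field; rewrite lt_eqF.
- move=> u; rewrite /w1; have [vu|vu] := ltP (v u) 0; last first.
    by apply: addr_ge0 => //; apply: mulr_ge0.
  have := u1min u vu; rewrite -/t /f ler_pdivlMr ?oppr_gt0 // mulrN.
  by rewrite lerNl -subr_ge0 opprK addrC.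
- by move=> u /w1sub; exact: wpos.
- move=> w' [w'0 w'a w'g w'I]; exists w'; split => //.
  - by move=> i; rewrite w'a w1lin vker mulr0 addr0.
  - by apply: le_trans w'g; rewrite w1lin lerDl mulr_ge0.
Qed.

End SupportReduction.

(** * The rate as a sum over the letters of U *)

Section Cardinality.
Context {R : realType} {X S Y Z Shat : finType} (M : bistatic R X S Y Z Shat).

Definition eta (t : R) := t * ln t.

Lemma etaM (a b : R) : 0 <= a -> 0 <= b -> eta (a * b) = a * eta b + eta a * b.
Proof.
rewrite /eta !le_eqVlt => /predU1P[<-|a0] /predU1P[<-|b0]; rewrite ?(mul0r,mulr0,addr0) //.
by rewrite lnM // mulrDr; ring.
Qed.

(** Contribution, in nats, of a letter of U whose unnormalised row is [p]. The rate is the sum of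
    these minus a term depending on the law of Z alone. *)
Definition gain (p : X -> R) : R :=
  \sum_x p x * (\sum_s \sum_y PS M s * eta (outY M x s y))
  + \sum_z eta (\sum_x p x * outZ M x z)
  - \sum_s \sum_y PS M s * eta (\sum_x p x * outY M x s y).

Section Rate.
Context {U : finType} (P : U * X -> R) (P_ge0 : forall u x, 0 <= P (u, x)).

Lemma aux_rate_gain : aux_rate M P * ln 2 =
  \sum_u gain (fun x => P (u, x)) - \sum_z eta (margZ M P z).
Proof.
rewrite aux_rate_density //.
transitivity (\sum_o joint_law M P o * ln (outY M (rvX o) (rvS o) (rvY o))
  + \sum_o joint_law M P o * ln (jointZ M P (rvU o) (rvZ o))
  - \sum_o joint_law M P o * ln (jointY M P (rvU o) (rvS o) (rvY o))
  - \sum_o joint_law M P o * ln (margZ M P (rvZ o))).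
  rewrite -!(sumrB, big_split) /=; apply: eq_bigr => -[[[[s u] x] y] z] _ /=.
  by ring.
rewrite sumrB big_split /=; congr (_ + _ - _ - _).
- rewrite sum_joint exchange_big /=; apply: eq_bigr => u _.
  rewrite exchange_big /=; apply: eq_bigr => x _.
  rewrite mulr_sumr; apply: eq_bigr => s _; rewrite mulr_sumr; apply: eq_bigr => y _.
  by rewrite -mulr_suml -mulr_sumr /eta /outY; ring.
- rewrite -(sum_law (joint_law M P) (rvpair rvU rvZ) (fun uz => ln (jointZ M P uz.1 uz.2))).
  by rewrite pair_bigA; apply: eq_bigr => -[u z] _; rewrite law_UZ.
- rewrite -(sum_law (joint_law M P) (rvpair rvY (rvpair rvU rvS))
    (fun yus => ln (jointY M P yus.2.1 yus.2.2 yus.1))).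
  rewrite /= -(pair_bigA _ (fun y us => law _ _ (y, us) * ln (jointY M P us.1 us.2 y))) /=.
  rewrite exchange_big /= -(pair_bigA _ (fun u s =>
    \sum_y law _ _ (y, (u, s)) * ln (jointY M P u s y))) /=.
  apply: eq_bigr => u _.
  by apply: eq_bigr => s _; apply: eq_bigr => y _; rewrite law_YUS mulrA.
- rewrite -(sum_law (joint_law M P) rvZ (fun z => ln (margZ M P z))).
  by apply: eq_bigr => z _; rewrite law_Z.
Qed.

End Rate.

(* [gain] is homogeneous because the two entropy terms have equal total mass. *)
Lemma gainZ (c : R) (p : X -> R) : 0 <= c -> (forall x, 0 <= p x) ->
  gain (fun x => c * p x) = c * gain p.
Proof.
move=> c0 p0; rewrite /gain mulrBr mulrDr.
have pull (f : X -> R) : \sum_x c * p x * f x = c * \sum_x p x * f x.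
  by rewrite mulr_sumr; apply: eq_bigr => x _; rewrite mulrA.
rewrite pull.
have -> : \sum_z eta (\sum_x c * p x * outZ M x z)
   = c * \sum_z eta (\sum_x p x * outZ M x z) + eta c * \sum_x p x.
  transitivity (\sum_z (c * eta (\sum_x p x * outZ M x z) + eta c * \sum_x p x * outZ M x z)).
    apply: eq_bigr => z _; rewrite pull etaM //.
    by apply: sumr_ge0 => x _; rewrite mulr_ge0 ?outZ_ge0.
  rewrite big_split -!mulr_sumr /= exchange_big /=; congr (_ + _ * _).
  by apply: eq_bigr => x _; rewrite -mulr_sumr sum_outZ mulr1.
have -> : \sum_s \sum_y PS M s * eta (\sum_x c * p x * outY M x s y)
   = c * (\sum_s \sum_y PS M s * eta (\sum_x p x * outY M x s y)) + eta c * \sum_x p x.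
  transitivity (\sum_s \sum_y (c * (PS M s * eta (\sum_x p x * outY M x s y))
      + eta c * (PS M s * \sum_x p x * outY M x s y))).
    apply: eq_bigr => s _; apply: eq_bigr => y _; rewrite pull etaM //.
      by ring.
    by apply: sumr_ge0 => x _; rewrite mulr_ge0 ?outY_ge0.
  under eq_bigr do rewrite big_split /=.
  rewrite big_split /=; congr (_ + _).
    by rewrite mulr_sumr; apply: eq_bigr => s _; rewrite mulr_sumr.
  rewrite -[X in _ = _ * X]mul1r -(sum_PS M) mulr_suml mulr_sumr.
  apply: eq_bigr => s _; rewrite -mulr_sumr -mulr_sumr; congr (_ * (_ * _)).
  rewrite exchange_big /=; apply: eq_bigr => x _.
  by rewrite -mulr_sumr sum_outY mulr1.
by ring.
Qed.

Lemma sum_enum_prefix (U : finType) (A : {set U}) (N : nat) (u0 : U) (F : U -> R) :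
  (#|A| <= N)%N ->
  \sum_(k < N) (if (k < #|A|)%N then F (nth u0 (enum A) k) else 0)
  = \sum_(u in A) F u.
Proof.
move=> AN; rewrite -[RHS]big_enum /= [RHS](big_nth u0) big_mkord -cardE.
by rewrite -big_mkcond /= (big_ord_widen _ (fun k => F (nth u0 (enum A) k)) AN).
Qed.

(** The program reweights the rows of [P]. Its constraints are the |X| values of P_X, which fix the
    total mass and the law of Z, and the distortion: |X| + 1 in all, indexed by [option X]. With the
    law of Z fixed, maximising the rate means maximising the sum of the gains. *)
Lemma cardinality_bound (U : finType) (P : U * X -> R) (h : U -> Z -> Shat) :
  is_pmf P ->
  exists (P' : 'I_(#|X| + 1) * X -> R) (h' : 'I_(#|X| + 1) -> Z -> Shat),
    [/\ is_pmf P', aux_distortion M P' h' = aux_distortion M P h &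
      aux_rate M P <= aux_rate M P'].
Proof.
move=> [P0 P1].
have P_ge0 u x : 0 <= P (u, x) by [].
have [[u0 _] _|no_u] := pickP (fun ux : U * X => true); last first.
  by move/eqP: P1; rewrite big1 1?eq_sym ?oner_eq0 // => ux; have := no_u ux.
pose a u (i : option X) := if i is Some x then P (u, x) else estimate_cost M P h u.
have aE u : \sum_(i | isSome i) a u i = margU P u.
  rewrite (reindex_omap Some id) => [|[]] //=.
  by apply: eq_bigl => x; rewrite eqxx.
(* The original [P] corresponds to weight 1; letters of probability 0 start with weight 0, since row
   sums must be positive on the support. *)
have [|u|u|w [w0 wa wg wX]] := @support_reduction R U (option X) a isSome
  (fun u => gain (fun x => P (u, x))) _ (fun u => (margU P u != 0)%:R).
- by move=> u; rewrite aE margU_ge0.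
- by rewrite ler0n.
- by rewrite pnatr_eq0 eqb0 negbK aE lt_neqAle eq_sym margU_ge0 // andbT.
have P00 u x : margU P u = 0 -> P (u, x) = 0.
  by move=> /psumr_eq0P ->.
rewrite card_option -addn1 in wX.
pose A := [set u | w u != 0].
(* The surviving letters occupy the first indices; the remaining indices get weight 0, and [u0] is
   only a default there. *)
pose nu (k : 'I_(#|X| + 1)) := nth u0 (enum A) k.
pose v (k : 'I_(#|X| + 1)) := if (k < #|A|)%N then w (nu k) else 0.
have v0 k : 0 <= v k by rewrite /v; case: ifP.
have sumv (F : U -> R) : \sum_k v k * F (nu k) = \sum_u w u * F u.
  transitivity (\sum_(u in A) w u * F u).
    rewrite -(sum_enum_prefix u0 _ wX); apply: eq_bigr => k _.
    by rewrite /v; case: ifP => // _; rewrite mul0r.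
  rewrite big_mkcond; apply: eq_bigr => u _; rewrite inE.
  by case: eqP => //= ->; rewrite mul0r.
pose P' (kx : 'I_(#|X| + 1) * X) := v kx.1 * P (nu kx.1, kx.2).
have P'_ge0 k x : 0 <= P' (k, x) by rewrite mulr_ge0.
have PX x : \sum_u w u * P (u, x) = \sum_u P (u, x).
  rewrite (wa (Some x)); apply: eq_bigr => u _ /=.
  by case: eqP => [/P00 ->|_]; rewrite ?mulr0 ?mul1r.
exists P', (fun k => h (nu k)); split.
- split; first by case.
  rewrite -P1 !sum_pair exchange_big [RHS]exchange_big /=.
  by apply: eq_bigr => x _; rewrite -PX -sumv.
- rewrite !aux_distortion_cost.
  transitivity (\sum_u w u * estimate_cost M P h u).
    rewrite -sumv; apply: eq_bigr => k _; rewrite /estimate_cost mulr_sumr.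
    by apply: eq_bigr => x _; rewrite mulrA.
  rewrite (wa None); apply: eq_bigr => u _ /=.
  case: eqP => [u00|_]; rewrite ?mul1r // mul0r.
  by rewrite /estimate_cost big1 // => x _; rewrite P00 ?mul0r.
- rewrite -(ler_pM2r ln2_gt0) !aux_rate_gain //.
  have -> : \sum_z eta (margZ M P' z) = \sum_z eta (margZ M P z).
    apply: eq_bigr => z _; congr eta; rewrite /margZ exchange_big [RHS]exchange_big /=.
    apply: eq_bigr => x _; rewrite -!mulr_suml; congr (_ * _).
    by rewrite -PX -sumv.
  rewrite lerD2r; apply: le_trans (le_trans wg _).
    apply: ler_sum => u _; case: eqP => [u00|_]; rewrite ?mul1r // mul0r.
    rewrite le_eqVlt; apply/orP; left; apply/eqP.
    transitivity (gain (fun x => 0 * P (u, x))); last by rewrite gainZ ?mul0r.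
    by congr gain; apply/funext => x; rewrite P00 ?mul0r.
  rewrite -sumv; apply: ler_sum => k _.
  by rewrite -gainZ.
Qed.

End Cardinality.

(** * Compactness *)

Section Compactness.
Local Open Scope classical_set_scope.
Context {R : realType}.

(** Only 0 is delicate. For 0 < s < 1, writing [ln (1 / s)] as twice [ln (1 / sqrt s)] and using
    [ln x <= x] bounds the absolute value of [s * ln s] by [2 * sqrt s]. To the left of 0 the
    function is constantly 0. *)
Lemma eta_continuous : continuous (@eta R).
Proof.
move=> t; have [t0|t0|->] := ltrgtP t 0.
- rewrite /continuous_at {2}/eta ln0 ?mulr0 ?ltW //.
  apply: cvg_near_cst; near=> s; rewrite /eta ln0 ?mulr0 // ltW //.
  by near: s; exact: lt_nbhsl.
- by apply: cvgM; [exact: cvg_id|exact: continuous_ln].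
- rewrite /continuous_at {2}/eta mul0r.
  have sq0 : (2 * Num.sqrt s) @[s --> (0 : R)] --> (0 : R).
    by have /(cvgMl_tmp (a := 2)) := @sqrt_continuous R 0; rewrite sqrtr0 mulr0.
  apply: (squeeze_cvgr (f := fun s => - (2 * Num.sqrt s)) _ _ sq0).
    near=> s; rewrite -ler_norml /eta.
    have s1 : s < 1 by near: s; exact: lt_nbhsl.
    have [s0|s0] := leP s 0; first by rewrite ln0 // mulr0 normr0 ler0_sqrtr // mulr0.
    rewrite normrM gtr0_norm // ler0_norm ?ln_le0 ?(ltW s1) // -lnV //.
    have r0 : 0 < Num.sqrt s by rewrite sqrtr_gt0.
    have -> : s^-1 = (Num.sqrt s)^-1 ^+ 2 by rewrite exprVn sqr_sqrtr ?(ltW s0).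
    rewrite lnXn ?invr_gt0 // -{1}(sqr_sqrtr (ltW s0)).
    have : ln (Num.sqrt s)^-1 <= (Num.sqrt s)^-1 by rewrite ltW // ln_sublinear ?invr_gt0.
    move=> /(ler_wpM2l (sqr_ge0 (Num.sqrt s))).
    rewrite {2}expr2 mulfK ?gt_eqF //.
    by rewrite mulrnAr mulr_natl ler_pMn2r.
  by have := cvgN sq0; rewrite oppr0; apply.
Unshelve. all: by end_near.
Qed.

Lemma continuous_sum (T : topologicalType) (I : finType) (F : I -> T -> R) :
  (forall i, continuous (F i)) -> continuous (fun v => \sum_i F i v).
Proof.
move=> F_cont; apply: continuous_big => // -[a b].
by apply: cvgD; [exact: cvg_fst|exact: cvg_snd].
Qed.

Section Arithmetic.
Context {T : topologicalType} (f g : T -> R).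
Hypotheses (f_cont : continuous f) (g_cont : continuous g).

Lemma continuous_add : continuous (fun v => f v + g v).
Proof. by move=> v; apply: cvgD; [exact: f_cont|exact: g_cont]. Qed.

Lemma continuous_sub : continuous (fun v => f v - g v).
Proof. by move=> v; apply: cvgB; [exact: f_cont|exact: g_cont]. Qed.

Lemma continuous_mulr c : continuous (fun v => f v * c).
Proof. by move=> v; apply: cvgM; [exact: f_cont|exact: cvg_cst]. Qed.

Lemma continuous_mull c : continuous (fun v => c * f v).
Proof. by move=> v; apply: cvgM; [exact: cvg_cst|exact: f_cont]. Qed.

Lemma continuous_eta : continuous (fun v => eta (f v)).
Proof.
move=> v; apply: (@continuous_comp _ _ _ f (@eta R)); first exact: f_cont.
exact: eta_continuous.
Qed.

End Arithmetic.

Section FinitePmf.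
Context {T : finType}.

(** Row vectors supply the topology and the compact cubes in which the simplex is a closed set. *)
Definition of_row (v : 'rV[R]_#|T|) (t : T) := v ord0 (enum_rank t).

Lemma of_row_continuous t : continuous (fun v => of_row v t).
Proof. exact: coord_continuous. Qed.

Lemma pmf_EVT (f g : (T -> R) -> R) (D : R) :
  continuous (f \o of_row) -> continuous (g \o of_row) ->
  (exists2 P, is_pmf P & g P <= D) ->
  exists P, [/\ is_pmf P, g P <= D &
    forall P', is_pmf P' -> g P' <= D -> f P' <= f P].
Proof.
move=> f_cont g_cont [P0 P0pmf P0D].
pose A : set 'rV[R]_#|T| := [set v | is_pmf (of_row v) /\ g (of_row v) <= D]%classic.
pose to_row (P : T -> R) : 'rV[R]_#|T| := \row_i P (enum_val i).
have to_rowK P : of_row (to_row P) = P.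
  by apply/funext => t; rewrite /of_row mxE enum_rankK.
have A0 : (A !=set0)%classic by exists (to_row P0); rewrite /A /= to_rowK.
have cA : compact A.
  have -> : A = ([set v : 'rV[R]_#|T| | forall i, [set` `[0, 1]%R] (v ord0 i)] `&`
    ((fun v => \sum_t of_row v t) @^-1` [set x | x = 1] `&`
     (g \o of_row) @^-1` [set x | x <= D]))%classic.
    apply/seteqP; split=> [v [[v0 v1] vD]|v [v01 [v1 vD]]] /=.
      split=> // i; rewrite /= in_itv /=; have := v0 (enum_val i).
      rewrite /of_row enum_valK => -> /=.
      rewrite -v1 (bigD1 (enum_val i)) //= {1}/of_row enum_valK lerDl.
      by apply: sumr_ge0.
    split=> //; split=> // t.
    by have /= := v01 (enum_rank t); rewrite in_itv /= => /andP[].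
  apply: compact_closedI.
    have cube := @rV_compact R #|T| (fun=> [set` `[0, 1]%R]); apply: cube => i.
    exact: segment_compact.
  apply: closedI; apply: closed_comp => //.
  by move=> v _; apply: continuous_sum => t; exact: of_row_continuous.
have [|c cA' cmax] := compact_EVT_max A0 cA (f := f \o of_row).
  exact: continuous_subspaceT.
have [cpmf cD] : A c by rewrite inE in cA'.
exists (of_row c); split=> // P' P'pmf P'D.
by rewrite -[P']to_rowK; apply: cmax; rewrite inE /A /= to_rowK.
Qed.

(** The parameter [h] will range over estimators: each feasible one has its own optimal pmf, and the
    best of these finitely many is taken. No continuity in [h] is involved. *)
Lemma pmf_family_EVT (H : finType) (f g : H -> (T -> R) -> R) (D : R) :
  (forall h, continuous (f h \o of_row)) ->
  (forall h, continuous (g h \o of_row)) ->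
  (exists h, exists2 P, is_pmf P & g h P <= D) ->
  exists h P, [/\ is_pmf P, g h P <= D &
    forall h' P', is_pmf P' -> g h' P' <= D -> f h' P' <= f h P].
Proof.
move=> f_cont g_cont [h0 h0P].
pose feasible h := `[< exists2 P, is_pmf P & g h P <= D >].
have /choice[best bestP] h : exists P, feasible h -> [/\ is_pmf P, g h P <= D &
    forall P', is_pmf P' -> g h P' <= D -> f h P' <= f h P].
  have [|nf] := boolP (feasible h); last by exists (fun=> 0).
  by move=> /asboolP /(pmf_EVT (f_cont h) (g_cont h))[P ?]; exists P.
have feas0 : feasible h0 by apply/asboolP.
case: (@Order.TotalTheory.arg_maxP _ _ _ h0 feasible (fun h => f h (best h)) feas0).
move=> h hf hmax; have [Ppmf PD Pmax] := bestP h hf.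
exists h, (best h); split=> // h' P' P'pmf P'D.
have h'f : feasible h' by apply/asboolP; exists P'.
have [_ _ /(_ P' P'pmf P'D) le'] := bestP h' h'f.
exact: le_trans le' (hmax h' h'f).
Qed.

End FinitePmf.
End Compactness.

(** * Optimal pairs of a pmf and an estimator *)

Section RateCompactness.
Local Open Scope classical_set_scope.
Context {R : realType} {X S Y Z Shat : finType} (M : bistatic R X S Y Z Shat).
Context {U : finType}.
Local Notation pmfs := (U * X -> R).

Definition rate_nats (P : pmfs) :=
  \sum_u gain M (fun x => P (u, x)) - \sum_z eta (margZ M P z).

Lemma rate_nats_continuous : continuous (rate_nats \o of_row).
Proof.
have c1 (f : X -> R) u : continuous (fun v : 'rV[R]_#|{: U * X}| =>
    \sum_x of_row v (u, x) * f x).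
  by apply: continuous_sum => x; apply: continuous_mulr; exact: of_row_continuous.
apply: (continuous_sub (f := fun v => \sum_u gain M (fun x => of_row v (u, x)))
  (g := fun v => \sum_z eta (margZ M (of_row v) z))).
  apply: (continuous_sum (F := fun u v => gain M (fun x => of_row v (u, x)))) => u.
  apply: continuous_sub; [apply: continuous_add|].
  - exact: c1.
  - by apply: continuous_sum => z; apply: continuous_eta; exact: c1.
  - apply: continuous_sum => s; apply: continuous_sum => y.
    by apply: continuous_mull; apply: continuous_eta; exact: c1.
apply: continuous_sum => z; apply: continuous_eta.
by apply: continuous_sum => u; exact: c1.
Qed.

Lemma distortion_continuous (h : U -> Z -> Shat) :
  continuous ((fun P => aux_distortion M P h) \o of_row).
Proof.
rewrite (_ : _ \o _ = fun v => \sum_u estimate_cost M (of_row v) h u); last first.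
  by apply/funext => v; rewrite /= aux_distortion_cost.
apply: continuous_sum => u; apply: continuous_sum => x.
by apply: continuous_mulr; exact: of_row_continuous.
Qed.

Definition cost_of (h : {ffun U -> {ffun Z -> Shat}}) (P : pmfs) :=
  aux_distortion M P (fun u => h u).

Lemma cost_of_ffun P (h : U -> Z -> Shat) :
  cost_of [ffun u => [ffun z => h u z]] P = aux_distortion M P h.
Proof.
congr aux_distortion; apply/funext => u; apply/funext => z.
by rewrite !ffunE.
Qed.

Lemma rate_natsE P : is_pmf P -> aux_rate M P = rate_nats P / ln 2.
Proof.
move=> [P0 _]; rewrite -[RHS]/(rate_nats P / _) /rate_nats -aux_rate_gain //.
by rewrite mulfK ?gt_eqF ?ln2_gt0.
Qed.

Lemma exists_best (D : R) :
  (exists (P : pmfs) h, is_pmf P /\ aux_distortion M P h <= D) ->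
  exists (P : pmfs) h, [/\ is_pmf P, aux_distortion M P h <= D &
    forall (P' : pmfs) h', is_pmf P' -> aux_distortion M P' h' <= D ->
      aux_rate M P' <= aux_rate M P].
Proof.
move=> [P0 [h0 [P0pmf P0D]]].
have [||h [P [Ppmf PD Pmax]]] := @pmf_family_EVT R _ {ffun U -> {ffun Z -> Shat}}
    (fun=> rate_nats) cost_of D (fun=> rate_nats_continuous).
- by move=> h; exact: distortion_continuous.
- by exists [ffun u => [ffun z => h0 u z]], P0; rewrite ?cost_of_ffun.
exists P, (fun u z => h u z); split=> // P' h' P'pmf P'D.
rewrite !rate_natsE // ler_pM2r ?invr_gt0 ?ln2_gt0 //.
by apply: (Pmax [ffun u => [ffun z => h' u z]]); rewrite ?cost_of_ffun.
Qed.

(** The larger of the two defects, in rate and in distortion, attains its minimum over the pairs. A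
    positive minimum would contradict the hypothesis taken at half its value. *)
Lemma rate_limit (r D : R) :
  (forall e, 0 < e -> exists (P : pmfs) h,
    [/\ is_pmf P, aux_distortion M P h <= D + e & r - e <= aux_rate M P]) ->
  exists (P : pmfs) h, [/\ is_pmf P, aux_distortion M P h <= D & r <= aux_rate M P].
Proof.
move=> H.
pose excess h (P : pmfs) := Num.max (r - rate_nats P / ln 2) (cost_of h P - D).
have [P1 [h1 [P1pmf _ _]]] := H 1 ltr01.
(* The extreme value lemma maximises, hence the factor -1; its constraint is filled with the trivial
   [0 <= 0]. *)
have [|||h [P [Ppmf _ Pmin]]] := @pmf_family_EVT R _ {ffun U -> {ffun Z -> Shat}}
    (fun h P => -1 * excess h P) (fun _ _ => 0) 0.
- move=> h; suff cexc : continuous (fun v => excess h (of_row v)).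
    exact: (continuous_mull cexc).
  move=> v; apply: (@continuous_max R _ (fun v => r - rate_nats (of_row v) / ln 2)
    (fun v => cost_of h (of_row v) - D) v).
    apply: continuous_sub; [exact: cst_continuous|apply: continuous_mulr].
    exact: rate_nats_continuous.
  by apply: continuous_sub; [exact: distortion_continuous|exact: cst_continuous].
- by move=> h; exact: cst_continuous.
- by exists [ffun u => [ffun z => h1 u z]], P1.
have [e0|e0] := leP (excess h P) 0.
  move: e0; rewrite /excess ge_max !subr_le0 -rate_natsE // => /andP[r0 d0].
  by exists P, (fun u z => h u z).
have [|P' [h' [P'pmf P'D P'r]]] := H (excess h P / 2); first by rewrite divr_gt0.
have := Pmin [ffun u => [ffun z => h' u z]] P' P'pmf (lexx _).
rewrite !mulN1r lerN2 {2}/excess cost_of_ffun -rate_natsE // => /le_trans.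
move=> /(_ (excess h P / 2)); rewrite ge_max => H'.
have : excess h P <= excess h P / 2 by apply: H'; apply/andP; split; lra.
lra.
Qed.

End RateCompactness.

(** * Converse *)

Section Puncture.
Context {R : realType} {I Z : finType}.

(** The hole is marked by [None], so that one alphabet serves every position. *)
Definition puncture (i : I) (z : {ffun I -> Z}) : {ffun I -> option Z} :=
  [ffun j => if j == i then None else Some (z j)].

(** The letters are independent, so the i-th one is independent of the sequence punctured at i. The
    map [pr] extracts the sensing output from a letter that also carries the state and the other
    output. *)
Lemma sum_puncture (T : finType) (p : I -> T -> R) (pr : T -> Z) (i : I)
    (G : {ffun I -> option Z} -> T -> R) :
  \sum_(t : {ffun I -> T}) (\prod_j p j (t j))
     * G (puncture i [ffun j => pr (t j)]) (t i)
  = \sum_(v : {ffun I -> option Z}) (v i == None)%:R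
     * (\prod_(j | j != i) \sum_a p j a * (v j == Some (pr a))%:R)
     * \sum_a p i a * G v a.
Proof.
pose e (v : {ffun I -> option Z}) j a :=
  (v j == if j == i then None else Some (pr a))%:R : R.
transitivity (\sum_(t : {ffun I -> T}) \sum_(v : {ffun I -> option Z})
    (\prod_j (p j (t j) * e v j (t j))) * G v (t i)).
  apply: eq_bigr => t _; rewrite -(sum_delta _ (fun v => _ * G v _)).
  apply: eq_bigr => v _; rewrite big_split /= mulrCA mulrA; congr (_ * _ * _).
  by rewrite -prod_eq_ffun; apply: eq_bigr => j _; rewrite /e /puncture !ffunE.
rewrite exchange_big /=; apply: eq_bigr => v _.
pose F j a := if j == i then p j a * e v j a * G v a else p j a * e v j a.
transitivity (\sum_(t : {ffun I -> T}) \prod_j F j (t j)).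
  apply: eq_bigr => t _; rewrite (bigD1 i) //= [RHS](bigD1 i) //= /F eqxx.
  rewrite mulrAC; congr (_ * _); apply: eq_bigr => j /negbTE ji.
  by rewrite ji.
rewrite sum_prod_ffun (bigD1 i) //= [RHS]mulrAC; congr (_ * _).
  rewrite mulr_sumr; apply: eq_bigr => a _.
  by rewrite /F /e eqxx; ring.
by apply: eq_bigr => j /negbTE ji; apply: eq_bigr => a _; rewrite /F /e ji.
Qed.

End Puncture.

(** * Single-letter bound for a block code *)

Section Converse.
Context {R : realType} {X S Y Z Shat : finType} (M : bistatic R X S Y Z Shat).
Context {m n : nat} (c : Defs.code X S Y Z Shat m n) (m_gt0 : (0 < m)%N) (n_gt0 : (0 < n)%N).

Local Notation Sn := {ffun 'I_n -> S}.
Local Notation Yn := {ffun 'I_n -> Y}.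
Local Notation Zn := {ffun 'I_n -> Z}.
Local Notation Un := ('I_n * {ffun 'I_n -> option Z})%type.

Lemma sum_block (F : 'I_m * Sn * Yn * Zn -> R) :
  \sum_o F o = \sum_w \sum_s \sum_y \sum_z F (w, s, y, z).
Proof. by rewrite !pair_bigA; apply: eq_bigr => -[[[]]]. Qed.

(* Law of (U_i, X_i) for i uniform and U_i = (i, Z^n without its i-th letter). *)
Definition converse_law (ux : Un * X) : R :=
  let: ((i, v), x) := ux in
  n%:R^-1 * \sum_w m%:R^-1 * (x == encoder c w i)%:R *
    \sum_(z : Zn) (\prod_j outZ M (encoder c w j) (z j)) * (v == puncture i z)%:R.

(** U_i and Z_i together determine Z^n, so a single-letter estimator can reproduce what the code
    estimates at position i. *)
Definition converse_estimator (u : Un) (z : Z) : Shat :=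
  estimator c [ffun j => odflt z (u.2 j)] u.1.

Lemma puncture_odflt (i : 'I_n) (z : Zn) :
  [ffun j => odflt (z i) (puncture i z j)] = z.
Proof. by apply/ffunP => j; rewrite !ffunE; case: eqP => [->|]. Qed.

(** Given the message, (S_i, Y_i, Z_i) is independent of the other outputs and depends on the
    codeword through X_i only. Hence a single-letter mean is a time average of block means. *)
Lemma sum_converse_law (F : S * Un * X * Y * Z -> R) :
  \sum_o joint_law M converse_law o * F o =
  n%:R^-1 * \sum_i expect (block_law M c) (fun '(w, s, y, z) =>
     F (s i, (i, puncture i z), encoder c w i, y i, z i)).
Proof.
(* The probability, given the message [w], that the output punctured at [i] is [v]. *)
pose wt w i (v : {ffun 'I_n -> option Z}) : R := (v i == None)%:R *
  \prod_(j | j != i) \sum_z outZ M (encoder c w j) z * (v j == Some z)%:R.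
pose G w i v (syz : S * Y * Z) : R := let: (s, y, z) := syz in
  F (s, (i, v), encoder c w i, y, z).
pose p w (j : 'I_n) (syz : S * Y * Z) : R := let: (s, y, z) := syz in
  PS M s * chan M (encoder c w j, s) (y, z).
have wtE w i v : \sum_(z : Zn) (\prod_j outZ M (encoder c w j) (z j))
    * (v == puncture i z)%:R = wt w i v.
  transitivity (\sum_(z : Zn) (\prod_j outZ M (encoder c w j) (z j))
    * (v == puncture i [ffun j => z j])%:R).
    apply: eq_bigr => z _; congr (_ * (_ == puncture i _)%:R).
    by apply/ffunP => j; rewrite ffunE.
  have /= -> := sum_puncture (fun j => outZ M (encoder c w j)) id i
    (fun v' _ => (v == v')%:R).
  transitivity (\sum_v' (v' == v)%:R * wt w i v'); last by rewrite sum_delta.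
  apply: eq_bigr => v' _; rewrite -mulr_suml sum_outZ mul1r mulrC.
  by rewrite (eq_sym v).
have block w i : \sum_(s : Sn) \sum_(y : Yn) \sum_(z : Zn) (\prod_j PS M (s j))
     * (\prod_j chan M (encoder c w j, s j) (y j, z j))
     * F (s i, (i, puncture i z), encoder c w i, y i, z i)
   = \sum_v wt w i v * \sum_a p w i a * G w i v a.
  under eq_bigr => s _ do rewrite sum_ffun_pair.
  rewrite sum_ffun_pair.
  transitivity (\sum_(t : {ffun 'I_n -> S * (Y * Z)})
    (\prod_j (fun a => p w j (a.1, a.2.1, a.2.2)) (t j)) *
    (fun v a => G w i v (a.1, a.2.1, a.2.2))
      (puncture i [ffun j => (t j).2.2]) (t i)).
    apply: eq_bigr => t _; rewrite !ffunE -big_split /=.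
    congr (_ * F (_, (i, puncture i _), _, _, _)).
      by apply: eq_bigr => j _; rewrite !ffunE.
    by apply/ffunP => j; rewrite !ffunE.
  rewrite (sum_puncture (fun j a => p w j (a.1, a.2.1, a.2.2))
    (fun a : S * (Y * Z) => a.2.2) i (fun v a => G w i v (a.1, a.2.1, a.2.2))).
  apply: eq_bigr => v _; congr (_ * _ * _).
    apply: eq_bigr => j _.
    rewrite !sum_pair; under eq_bigr do rewrite sum_pair exchange_big /=.
    rewrite exchange_big /=; apply: eq_bigr => z _; rewrite /outZ mulr_suml.
    by apply: eq_bigr => s _; rewrite mulr_suml.
  rewrite !sum_pair; apply: eq_bigr => s _.
  by rewrite sum_pair.
have expE i : expect (block_law M c) (fun '(w, s, y, z) =>
     F (s i, (i, puncture i z), encoder c w i, y i, z i))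
   = \sum_w m%:R^-1 * \sum_v wt w i v * (\sum_a p w i a * G w i v a).
  rewrite /expect sum_block; apply: eq_bigr => w _; rewrite -block.
  do 3 (rewrite mulr_sumr; apply: eq_bigr => ? _).
  by rewrite /= !mulrA.
under [in RHS]eq_bigr do rewrite expE.
rewrite sum_joint exchange_big /= sum_pair mulr_sumr; apply: eq_bigr => i _.
transitivity (\sum_v n%:R^-1 * \sum_w m%:R^-1 *
    (wt w i v * \sum_a p w i a * G w i v a)); last first.
  rewrite -mulr_sumr exchange_big; congr (_ * _); apply: eq_bigr => w _.
  by rewrite mulr_sumr.
apply: eq_bigr => v _.
pose H x := \sum_s \sum_y \sum_z PS M s * chan M (x, s) (y, z) * F (s, (i, v), x, y, z).
transitivity (\sum_x converse_law ((i, v), x) * H x).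
  rewrite exchange_big /=; apply: eq_bigr => x _; rewrite /H.
  move: (n%:R^-1 * _) => q.
  by do 3 (rewrite mulr_sumr; apply: eq_bigr => ? _); rewrite !mulrA.
transitivity (\sum_x \sum_w (x == encoder c w i)%:R *
    (n%:R^-1 * (m%:R^-1 * (wt w i v * H x)))).
  apply: eq_bigr => x _; rewrite /= -mulrA mulr_suml mulr_sumr.
  by apply: eq_bigr => w _; rewrite wtE; ring.
rewrite exchange_big mulr_sumr; apply: eq_bigr => w _ /=.
rewrite sum_delta /H; congr (_ * (_ * (_ * _))).
by rewrite sum_pair sum_pair.
Qed.

Lemma block_law_ge0 o : 0 <= block_law M c o.
Proof.
case: o => [[[w s] y] z]; rewrite !mulr_ge0 ?invr_ge0 ?ler0n //.
  by apply: prodr_ge0 => i _; exact: PS_ge0.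
by apply: prodr_ge0 => i _; exact: chan_ge0.
Qed.

Lemma converse_law_ge0 u x : 0 <= converse_law (u, x).
Proof.
case: u => i v; rewrite /= mulr_ge0 ?invr_ge0 ?ler0n // sumr_ge0 // => w _.
rewrite !mulr_ge0 ?invr_ge0 ?ler0n // sumr_ge0 // => z _.
by rewrite mulr_ge0 ?ler0n // prodr_ge0 // => j _; exact: outZ_ge0.
Qed.

Lemma sum_msg (F : R) : \sum_(w < m) m%:R^-1 * F = F.
Proof.
rewrite sumr_const card_ord -[LHS]mulr_natl mulrA mulfV ?mul1r //.
by rewrite pnatr_eq0 -lt0n.
Qed.

Lemma block_law_pmf : is_pmf (block_law M c).
Proof.
split; first exact: block_law_ge0.
rewrite sum_block -[RHS]sum_msg; apply: eq_bigr => w _; rewrite mulr1.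
transitivity (m%:R^-1 * \sum_(s : Sn) (\prod_i PS M (s i)) *
  \sum_(y : Yn) \prod_i outY M (encoder c w i) (s i) (y i)).
  rewrite mulr_sumr; apply: eq_bigr => s _; rewrite mulrA mulr_sumr.
  apply: eq_bigr => y _; rewrite /= -mulr_sumr; congr (_ * _).
  by rewrite (sum_prod_ffun (fun i z => chan M (encoder c w i, s i) (y i, z))).
rewrite [X in _ * X](_ : _ = 1) ?mulr1 //.
transitivity (\sum_(s : Sn) \prod_i PS M (s i)); last first.
  by rewrite (sum_prod_ffun (fun _ => PS M)) big1 // => i _; rewrite sum_PS.
apply: eq_bigr => s _.
rewrite (sum_prod_ffun (fun i => outY M (encoder c w i) (s i))).
rewrite [X in _ * X]big1 ?mulr1 //.
by move=> i _; rewrite sum_outY.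
Qed.

Lemma converse_law_pmf : is_pmf converse_law.
Proof.
split=> [[u x]|]; first exact: converse_law_ge0.
have := sum_converse_law (fun=> 1).
have n0 : n%:R != 0 :> R by rewrite pnatr_eq0 -lt0n.
have -> : n%:R^-1 * \sum_(i < n) expect (block_law M c) (fun '(w, s, y, z) => 1) = 1 :> R.
  have -> : expect (block_law M c) (fun '(w, s, y, z) => 1) = 1.
    transitivity (\sum_o block_law M c o); last by case: block_law_pmf.
    by apply: eq_bigr => -[[[? ?] ?] ?] _; rewrite /= mulr1.
  by rewrite sumr_const card_ord mulVf.
by move=> <-; under [RHS]eq_bigr do rewrite mulr1; rewrite sum_joint_law.
Qed.

Lemma converse_distortion :
  aux_distortion M converse_law converse_estimator = distortion M c.
Proof.
rewrite /aux_distortion /expect.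
rewrite (sum_converse_law (fun o => dist M (rvS o) (converse_estimator (rvU o) (rvZ o)))).
congr (_ * _); apply: eq_bigr => i _; apply: eq_bigr => -[[[w s] y] z] _.
by rewrite /= /converse_estimator /= puncture_odflt.
Qed.

Context (Q : Y -> Z -> R) (Q_pmf : forall y, is_pmf (Q y)).
Hypothesis markov : forall x s y z, chan M (x, s) (y, z) = outY M x s y * Q y z.

(** Half uniform, half on the decoded message: at least 1/2 when decoding is right and at least
    1/(2m) always. After multiplication by m, its logarithm is at least ln m - ln 2 on success and -
    ln 2 on error, which is Fano's inequality. *)
Definition guess (w : 'I_m) (s : Sn) (y : Yn) : R :=
  (2 * m%:R)^-1 + 2^-1 * (w == decoder c y s)%:R.

(* Mass at most 1: summing over s_i and y_i turns the i-th factor into the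
   marginal of z_i, since S_i is independent of the punctured outputs. *)
Definition test_law (o : 'I_m * Sn * Yn * Zn) : R :=
  let: (w, s, y, z) := o in
  guess w s y * \prod_i (PS M (s i) * Q (y i) (z i)
    * jointY M converse_law (i, puncture i z) (s i) (y i)
    * (margZ M converse_law (z i) / jointZ M converse_law (i, puncture i z) (z i))).

Lemma m_neq0 : m%:R != 0 :> R.
Proof. by rewrite pnatr_eq0 -lt0n. Qed.

Lemma sum_guess s y : \sum_w guess w s y = 1.
Proof.
rewrite big_split /= -mulr_sumr.
have -> : \sum_w (w == decoder c y s)%:R = 1 :> R.
  by under eq_bigr do rewrite -[_%:R]mulr1; rewrite (sum_delta _ (fun=> 1)).
rewrite sumr_const card_ord -[X in X + _]mulr_natl; field; exact: m_neq0.
Qed.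

Lemma guess_gt0 w s y : 0 < guess w s y.
Proof.
by rewrite ltr_pwDl ?invr_gt0 ?mulr_gt0 ?ltr0n // mulr_ge0 ?invr_ge0 ?ler0n.
Qed.

Lemma Q_ge0 y z : 0 <= Q y z.
Proof. by case: (Q_pmf y). Qed.

Lemma test_law_ge0 o : 0 <= test_law o.
Proof.
case: o => [[[w s] y] z]; rewrite mulr_ge0 ?(ltW (guess_gt0 _ _ _)) //.
apply: prodr_ge0 => i _; rewrite !mulr_ge0 ?PS_ge0 ?Q_ge0 ?invr_ge0 //.
- by apply: jointY_ge0; exact: converse_law_ge0.
- by apply: margZ_ge0; exact: converse_law_ge0.
- by apply: jointZ_ge0; exact: converse_law_ge0.
Qed.

Lemma sum_test_law : \sum_o test_law o <= 1.
Proof.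
rewrite sum_block exchange_big /=.
have -> : \sum_(s : Sn) \sum_(w < m) \sum_(y : Yn) \sum_(z : Zn) test_law (w, s, y, z)
  = \sum_(z : Zn) \prod_i (jointZ M converse_law (i, puncture i z) (z i)
    * (margZ M converse_law (z i) / jointZ M converse_law (i, puncture i z) (z i))).
  transitivity (\sum_(s : Sn) \sum_(y : Yn) \sum_(z : Zn)
    \prod_i (fun i (a : S * Y) => PS M a.1 * Q a.2 (z i)
    * jointY M converse_law (i, puncture i z) a.1 a.2
    * (margZ M converse_law (z i) / jointZ M converse_law (i, puncture i z) (z i)))
     i (s i, y i)).
    apply: eq_bigr => s _; rewrite exchange_big /=; apply: eq_bigr => y _.
    rewrite exchange_big /=; apply: eq_bigr => z _.
    by rewrite -mulr_suml sum_guess mul1r.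
  under eq_bigr => s _ do rewrite exchange_big /=.
  rewrite exchange_big /=; apply: eq_bigr => z _; rewrite sum_ffun_pair.
  transitivity (\prod_i \sum_(a : S * Y) (PS M a.1 * Q a.2 (z i)
    * jointY M converse_law (i, puncture i z) a.1 a.2
    * (margZ M converse_law (z i) / jointZ M converse_law (i, puncture i z) (z i)))); last first.
    apply: eq_bigr => i _; rewrite -mulr_suml; congr (_ * _).
    by rewrite sum_pair jointZ_markov //.
  rewrite -(sum_prod_ffun (fun i (a : S * Y) => PS M a.1 * Q a.2 (z i)
    * jointY M converse_law (i, puncture i z) a.1 a.2
    * (margZ M converse_law (z i) / jointZ M converse_law (i, puncture i z) (z i)))).
  by apply: eq_bigr => h _; apply: eq_bigr => i _; rewrite !ffunE.
(* [jointZ] cancels against its inverse except where it is 0; there the factor vanishes, hence an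
   inequality only. *)
apply: (@le_trans _ _ (\sum_(z : Zn) \prod_i margZ M converse_law (z i))); last first.
  rewrite (sum_prod_ffun (fun _ => margZ M converse_law)) big1 // => i _.
  exact: (sum_margZ M converse_law_pmf).
have pz0 z : 0 <= margZ M converse_law z by apply: margZ_ge0; exact: converse_law_ge0.
have jz0 u z : 0 <= jointZ M converse_law u z.
  by apply: jointZ_ge0; exact: converse_law_ge0.
apply: ler_sum => z _; apply: ler_prod => i _.
rewrite !mulr_ge0 ?invr_ge0 //=.
have [->|j0] := eqVneq (jointZ M converse_law (i, puncture i z) (z i)) 0.
  by rewrite mul0r.
by rewrite mulrCA mulfV // mulr1.
Qed.

Lemma block_law_gt0 w s y z : 0 < block_law M c (w, s, y, z) ->
  forall i, 0 < PS M (s i) /\ 0 < chan M (encoder c w i, s i) (y i, z i).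
Proof.
move=> p i; split.
  rewrite lt_neqAle PS_ge0 andbT eq_sym; apply: contraTneq p => s0.
  by rewrite /= (bigD1 i) //= s0 mul0r mulr0 mul0r ltxx.
rewrite lt_neqAle chan_ge0 andbT eq_sym; apply: contraTneq p => c0.
by rewrite /= [X in _ * X](bigD1 i) //= c0 mul0r mulr0 ltxx.
Qed.

Lemma converse_law_gt0 w s y z i : 0 < block_law M c (w, s, y, z) ->
  0 < converse_law ((i, puncture i z), encoder c w i).
Proof.
move=> /block_law_gt0 pos.
rewrite /= mulr_gt0 ?invr_gt0 ?ltr0n // (sum_gt0 (a := w)) //.
  move=> w'; rewrite !mulr_ge0 ?invr_ge0 ?ler0n // sumr_ge0 // => z' _.
  by rewrite mulr_ge0 ?ler0n // prodr_ge0 // => j _; exact: outZ_ge0.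
rewrite eqxx !mulr_gt0 ?invr_gt0 ?ltr0n // (sum_gt0 (a := z)) //.
  by move=> z'; rewrite mulr_ge0 ?ler0n // prodr_ge0 // => j _; exact: outZ_ge0.
rewrite eqxx mulr1; apply: prodr_gt0 => j _; have [Sj cj] := pos j.
exact: outZ_gt0 Sj cj.
Qed.

(** The log-ratio of the test law to the block law is [lnguess - dens], so the Gibbs inequality puts
    the mean of [lnguess] below the mean of [dens], which is n times the single-letter rate. *)
Lemma converse_rate : (1 - error_prob M c) * ln m%:R - ln 2
  <= n%:R * (aux_rate M converse_law * ln 2).
Proof.
have P_ge0 u x : 0 <= converse_law (u, x) by exact: converse_law_ge0.
pose dens (o : 'I_m * Sn * Yn * Zn) : R := let: (w, s, y, z) := o in
  \sum_i info_density M converse_law (s i, (i, puncture i z), encoder c w i, y i, z i).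
have -> : n%:R * (aux_rate M converse_law * ln 2) = \sum_o block_law M c o * dens o.
  rewrite aux_rate_density // sum_converse_law mulrA divff ?mul1r; last first.
    by rewrite pnatr_eq0 -lt0n.
  rewrite exchange_big /=; apply: eq_bigr => -[[[w s] y] z] _.
  by rewrite -mulr_sumr.
pose lnguess (o : 'I_m * Sn * Yn * Zn) : R := let: (w, s, y, z) := o in
  ln (m%:R * guess w s y).
(* The factors P_S(s_i) and p(z_i|y_i) occur in both laws and cancel; the remaining ones make up the
   information density. *)
have pos : forall o, 0 < block_law M c o -> 0 < test_law o /\
   ln (test_law o) - ln (block_law M c o) = lnguess o - dens o.
  move=> [[[w s] y] z] p.
  have spos i : 0 < PS M (s i) by have [] := block_law_gt0 p i.
  have cpos i : 0 < chan M (encoder c w i, s i) (y i, z i) by have [] := block_law_gt0 p i.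
  have ypos i := outY_gt0 (cpos i).
  have qpos i : 0 < Q (y i) (z i).
    by have := cpos i; rewrite markov pmulr_rgt0.
  have Ppos i := converse_law_gt0 i p.
  have zpos i := outZ_gt0 (spos i) (cpos i).
  have BY i := jointY_gt0 P_ge0 (Ppos i) (ypos i).
  have BZ i := jointZ_gt0 P_ge0 (Ppos i) (zpos i).
  have MZ i := margZ_gt0 P_ge0 (BZ i).
  have tpos i : 0 < PS M (s i) * Q (y i) (z i)
      * jointY M converse_law (i, puncture i z) (s i) (y i)
      * (margZ M converse_law (z i) / jointZ M converse_law (i, puncture i z) (z i)).
    by rewrite !mulr_gt0 ?invr_gt0.
  split; first by rewrite mulr_gt0 ?guess_gt0 // prodr_gt0.
  have m0 : 0 < m%:R :> R by rewrite ltr0n.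
  rewrite /= !lnM ?posrE ?mulr_gt0 ?invr_gt0 ?guess_gt0 ?prodr_gt0 //.
  rewrite !ln_prod // lnV //.
  suff : \sum_i (ln (PS M (s i) * Q (y i) (z i)
      * jointY M converse_law (i, puncture i z) (s i) (y i)
      * (margZ M converse_law (z i) / jointZ M converse_law (i, puncture i z) (z i)))
    - ln (PS M (s i)) - ln (chan M (encoder c w i, s i) (y i, z i))
    + info_density M converse_law (s i, (i, puncture i z), encoder c w i, y i, z i)) = 0.
    by rewrite big_split /= !sumrB; lra.
  apply: big1 => i _; rewrite markov.
  rewrite !lnM ?posrE ?mulr_gt0 ?invr_gt0 // lnV ?posrE //=; ring.
have := gibbs block_law_pmf test_law_ge0 (fun o p => (pos o p).1) sum_test_law.
have -> : \sum_o block_law M c o * (ln (test_law o) - ln (block_law M c o))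
    = \sum_o block_law M c o * lnguess o - \sum_o block_law M c o * dens o.
  rewrite -sumrB; apply: eq_bigr => o _; rewrite -mulrBr.
  have [->|p0] := eqVneq (block_law M c o) 0; first by rewrite !mul0r.
  by rewrite (pos o _).2 // lt_neqAle eq_sym p0 block_law_ge0.
rewrite subr_le0; apply: le_trans.
have err : error_prob M c = \sum_o block_law M c o *
    (let: (w, s, y, z) := o in (decoder c y s != w)%:R).
  rewrite /error_prob /prob big_mkcond; apply: eq_bigr => -[[[w s] y] z] _.
  by case: (_ != _); rewrite ?mulr1 ?mulr0.
have -> : (1 - error_prob M c) * ln m%:R - ln 2 = \sum_o block_law M c o *
    ((1 - (let: (w, s, y, z) := o in (decoder c y s != w)%:R)) * ln m%:R - ln 2).
  under [RHS]eq_bigr do rewrite mulrBr mulrA mulrBr mulr1.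
  rewrite sumrB -!mulr_suml sumrB -err.
  by have [_ ->] := block_law_pmf; rewrite mul1r.
apply: ler_sum => -[[[w s] y] z] _; apply: ler_wpM2l; first exact: block_law_ge0.
have m1 : 1 <= m%:R :> R by rewrite ler1n.
have m0 : 0 < m%:R :> R by rewrite ltr0n.
rewrite /lnguess /guess [w == _]eq_sym; case: eqP => _ /=.
  rewrite subr0 mul1r -ln_div ?posrE // ler_ln ?posrE ?divr_gt0 //; last first.
    by rewrite mulr_gt0 // ltr_wpDl ?mulr1 ?invr_gt0 // invr_ge0 mulr_ge0.
  by rewrite ler_pM2l // mulr1 lerDr invr_ge0 mulr_ge0.
rewrite subrr mul0r sub0r -lnV ?posrE // mulr0 addr0 invfM mulrCA mulfV ?m_neq0 //.
by rewrite mulr1.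
Qed.

End Converse.

(** * Random coding *)

Section RandomCoding.
Context {R : realType} {X S Y Z Shat : finType} (M : bistatic R X S Y Z Shat).
Context {U : finType} (PU : U -> R) (V : U -> X -> R).
Hypotheses (PU_pmf : is_pmf PU) (V_pmf : forall u, is_pmf (V u)).

(* p(y|u,s), p(z|u), p(y|s) and p(z) for U ~ PU and X ~ V U. *)
Definition condY u s y := \sum_x V u x * outY M x s y.
Definition condZ u z := \sum_x V u x * outZ M x z.
Definition mixY s y := \sum_u PU u * condY u s y.
Definition mixZ z := \sum_u PU u * condZ u z.

Lemma condY_ge0 u s y : 0 <= condY u s y.
Proof. by apply: sumr_ge0 => x _; rewrite mulr_ge0 ?outY_ge0 //; case: (V_pmf u). Qed.

Lemma condZ_ge0 u z : 0 <= condZ u z.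
Proof. by apply: sumr_ge0 => x _; rewrite mulr_ge0 ?outZ_ge0 //; case: (V_pmf u). Qed.

Lemma mixY_ge0 s y : 0 <= mixY s y.
Proof. by apply: sumr_ge0 => u _; rewrite mulr_ge0 ?condY_ge0 //; case: PU_pmf. Qed.

Lemma mixZ_ge0 z : 0 <= mixZ z.
Proof. by apply: sumr_ge0 => u _; rewrite mulr_ge0 ?condZ_ge0 //; case: PU_pmf. Qed.

Context (g1 g2 g3 : R) (g1_gt0 : 0 < g1) (g2_gt0 : 0 < g2) (g3_gt0 : 0 < g3).

(** The thresholds appear as factors, so no likelihood is divided by one that may be 0; the
    collision bounds use the tests in this form. *)
Definition test_cloud u z := g1 * mixZ z <= condZ u z.
Definition test_satellite u x s y := g2 * condY u s y <= outY M x s y.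
Definition test_pair x s y := g3 * mixY s y <= outY M x s y.

Context {N m : nat} (cloud : 'I_m -> 'I_N) (k0 : 'I_N) (w0 : 'I_m).

Definition codebook := ({ffun 'I_N -> U} * {ffun 'I_m -> X})%type.

Definition accept (cb : codebook) y s w :=
  test_satellite (cb.1 (cloud w)) (cb.2 w) s y && test_pair (cb.2 w) s y.

Definition decode (cb : codebook) y s : 'I_m := odflt w0 [pick w | accept cb y s w].

Definition sense (cb : codebook) z : 'I_N :=
  odflt k0 [pick k | test_cloud (cb.1 k) z].

(** A false candidate in the sent cloud is charged to the satellite test at the true centre, one in
    another cloud to the pair test. This is why acceptance demands both. *)
Lemma decode_union cb y s w : (decode cb y s != w)%:R <=
  (~~ test_satellite (cb.1 (cloud w)) (cb.2 w) s y)%:R + (~~ test_pair (cb.2 w) s y)%:R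
  + \sum_(w' | w' != w) (if cloud w' == cloud w
      then test_satellite (cb.1 (cloud w)) (cb.2 w') s y
      else test_pair (cb.2 w') s y)%:R :> R.
Proof.
apply: ind_le => [|wrong]; first by rewrite !addr_ge0 ?sumr_ge0.
have s0 : 0 <= \sum_(w' | w' != w) (if cloud w' == cloud w
      then test_satellite (cb.1 (cloud w)) (cb.2 w') s y
      else test_pair (cb.2 w') s y)%:R :> R by apply: sumr_ge0.
case T2: (test_satellite (cb.1 (cloud w)) (cb.2 w) s y); last first.
  by rewrite /= -addrA lerDl addr_ge0.
case T3: (test_pair (cb.2 w) s y); last by rewrite /= add0r lerDl.
rewrite /= add0r add0r; move: wrong; rewrite /decode.
case: pickP => [w' /= /andP[T2' T3'] w'w|/(_ w)]; last by rewrite /accept T2 T3.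
rewrite (bigD1 w') //= (_ : (if _ then _ else _) = true) ?lerDl ?sumr_ge0 //.
by case: eqP => [<-|].
Qed.

Lemma sense_union cb z k : (sense cb z != k)%:R <=
  (~~ test_cloud (cb.1 k) z)%:R + \sum_(k' | k' != k) (test_cloud (cb.1 k') z)%:R :> R.
Proof.
apply: ind_le => [|wrong]; first by rewrite !addr_ge0 ?sumr_ge0.
case T1: (test_cloud (cb.1 k) z); last by rewrite /= lerDl sumr_ge0.
rewrite /= add0r; move: wrong; rewrite /sense.
case: pickP => [k' /= T1' k'k|/(_ k)]; last by rewrite T1.
by rewrite (bigD1 k') //= T1' lerDl sumr_ge0.
Qed.

Definition codebook_law (cb : codebook) : R :=
  (\prod_k PU (cb.1 k)) * \prod_w V (cb.1 (cloud w)) (cb.2 w).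

Lemma codebook_law_ge0 cb : 0 <= codebook_law cb.
Proof.
rewrite mulr_ge0 ?prodr_ge0 // => [k _|w _]; first by case: PU_pmf.
by case: (V_pmf (cb.1 (cloud w))).
Qed.

(** Codebook entries not involved sum to 1. This and the next three lemmas treat the ways in which
    the sent and the competing entries depend on each other. *)
Lemma average_one w (phi : U -> X -> R) :
  \sum_cb codebook_law cb * phi (cb.1 (cloud w)) (cb.2 w)
  = \sum_u PU u * \sum_x V u x * phi u x.
Proof.
rewrite sum_pair -(sum_ffun1 (P := fun _ : 'I_N => PU) (cloud w)
  (fun u => \sum_x V u x * phi u x)) => [|k]; last by case: PU_pmf.
apply: eq_bigr => uc _; rewrite -(sum_ffun1 (P := fun w => V (uc (cloud w))) w
  (fun x => phi (uc (cloud w)) x)) => [|w']; last by case: (V_pmf (uc (cloud w'))).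
by rewrite mulr_sumr; apply: eq_bigr => xc _; rewrite -mulrA.
Qed.

Lemma average_same_cloud w w' (phi : U -> X -> X -> R) :
  w != w' -> cloud w' = cloud w ->
  \sum_cb codebook_law cb * phi (cb.1 (cloud w)) (cb.2 w) (cb.2 w')
  = \sum_u PU u * \sum_x \sum_x' V u x * (V u x' * phi u x x').
Proof.
move=> ww' cl.
rewrite sum_pair -(sum_ffun1 (P := fun _ : 'I_N => PU) (cloud w)
  (fun u => \sum_x \sum_x' V u x * (V u x' * phi u x x'))) => [|k]; last by case: PU_pmf.
apply: eq_bigr => uc _.
have := sum_ffun2 (P := fun w => V (uc (cloud w)))
  (fun x x' => phi (uc (cloud w)) x x') (fun w => (V_pmf (uc (cloud w))).2) ww'.
rewrite /= cl => <-.
by rewrite mulr_sumr; apply: eq_bigr => xc _; rewrite -mulrA.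
Qed.

Lemma average_other_message w w' (phi : X -> X -> R) : cloud w' != cloud w ->
  \sum_cb codebook_law cb * phi (cb.2 w) (cb.2 w')
  = \sum_u \sum_u' PU u * (PU u' * \sum_x \sum_x' V u x * (V u' x' * phi x x')).
Proof.
move=> cl; have ww' : w != w' by apply: contraNneq cl => ->.
rewrite sum_pair -(sum_ffun2 (P := fun _ : 'I_N => PU)
  (fun u u' => \sum_x \sum_x' V u x * (V u' x' * phi x x')) _ (_ : cloud w != cloud w'));
  [|by case: PU_pmf|by rewrite eq_sym].
apply: eq_bigr => uc _.
rewrite -(sum_ffun2 (P := fun w => V (uc (cloud w))) phi _ ww') => [|w''];
  last by case: (V_pmf (uc (cloud w''))).
by rewrite mulr_sumr; apply: eq_bigr => xc _; rewrite -mulrA.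
Qed.

Lemma average_other_cloud w k (phi : X -> U -> R) : k != cloud w ->
  \sum_cb codebook_law cb * phi (cb.2 w) (cb.1 k)
  = \sum_u \sum_u' PU u * (PU u' * \sum_x V u x * phi x u').
Proof.
rewrite eq_sym => kw.
rewrite sum_pair -(sum_ffun2 (P := fun _ : 'I_N => PU)
  (fun u u' => \sum_x V u x * phi x u') _ kw) => [|?]; last by case: PU_pmf.
apply: eq_bigr => uc _.
rewrite -(sum_ffun1 (P := fun w => V (uc (cloud w))) w (fun x => phi x (uc k)))
  => [|w']; last by case: (V_pmf (uc (cloud w'))).
by rewrite mulr_sumr; apply: eq_bigr => xc _; rewrite -mulrA.
Qed.

Lemma codebook_law_pmf : is_pmf codebook_law.
Proof.
split; first exact: codebook_law_ge0.
have := average_one w0 (fun _ _ => 1).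
under eq_bigr do rewrite mulr1.
move=> ->; rewrite -[RHS]PU_pmf.2; apply: eq_bigr => u _.
by under eq_bigr do rewrite mulr1; rewrite (V_pmf u).2 mulr1.
Qed.

Lemma sum_mix (T : finType) (v : T -> R) (F : T -> S -> Y -> R) (t : S -> Y -> R) :
  \sum_a v a * \sum_s \sum_y PS M s * F a s y * t s y
  = \sum_s \sum_y PS M s * (\sum_a v a * F a s y) * t s y.
Proof.
under eq_bigr do rewrite mulr_sumr.
rewrite exchange_big; apply: eq_bigr => s _ /=.
under eq_bigr do rewrite mulr_sumr.
rewrite exchange_big; apply: eq_bigr => y _ /=.
by rewrite mulr_sumr mulr_suml; apply: eq_bigr => a _; ring.
Qed.

Lemma sum_mixZ (T : finType) (v : T -> R) (F : T -> Z -> R) (t : Z -> R) :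
  \sum_a v a * \sum_z F a z * t z = \sum_z (\sum_a v a * F a z) * t z.
Proof.
under eq_bigr do rewrite mulr_sumr.
rewrite exchange_big; apply: eq_bigr => z _ /=.
by rewrite mulr_suml; apply: eq_bigr => a _; ring.
Qed.

Lemma scaled_outY g x : \sum_s \sum_y PS M s * (g^-1 * outY M x s y) = g^-1.
Proof.
rewrite -[RHS]mulr1 -(sum_PS M) mulr_sumr; apply: eq_bigr => s _.
by rewrite -mulr_sumr -mulr_sumr sum_outY mulr1 mulrC.
Qed.

(** Change of measure: given the centre, the wrong codeword x' is independent of y, whose law is
    p(y|u,s). A passed test bounds this by p(y|x',s) / g2, and p(y|x',s) sums to 1 over y. The next
    two bounds follow the same pattern, with p(y|s) and p(z) as the output laws. *)
Lemma satellite_collision w w' : w != w' -> cloud w' = cloud w ->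
  \sum_cb codebook_law cb * (\sum_s \sum_y PS M s * outY M (cb.2 w) s y *
     (test_satellite (cb.1 (cloud w)) (cb.2 w') s y)%:R) <= g2^-1.
Proof.
move=> ww' cl.
rewrite (average_same_cloud (fun u x x' => \sum_s \sum_y PS M s * outY M x s y *
   (test_satellite u x' s y)%:R) ww' cl).
apply: average_const => // u; rewrite exchange_big /=.
apply: (@le_trans _ _ (\sum_x' V u x' * g2^-1)); last first.
  by rewrite -mulr_suml (V_pmf u).2 mul1r.
apply: ler_sum => x' _; under eq_bigr do rewrite mulrCA.
rewrite -mulr_sumr; apply: ler_wpM2l; first by case: (V_pmf u).
rewrite (sum_mix _ (outY M)) -(scaled_outY g2 x').
apply: ler_sum => s _; apply: ler_sum => y _; rewrite -mulrA.
by apply: ler_wpM2l; [exact: PS_ge0|apply: ind_ratio; rewrite ?outY_ge0].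
Qed.

Lemma pair_collision w w' : cloud w' != cloud w ->
  \sum_cb codebook_law cb * (\sum_s \sum_y PS M s * outY M (cb.2 w) s y *
     (test_pair (cb.2 w') s y)%:R) <= g3^-1.
Proof.
move=> cl.
rewrite (average_other_message (fun x x' => \sum_s \sum_y PS M s * outY M x s y *
   (test_pair x' s y)%:R) cl).
rewrite exchange_big /=; under eq_bigr do under eq_bigr do rewrite mulrCA.
under eq_bigr do rewrite -mulr_sumr.
apply: average_const => // u'.
under eq_bigr do rewrite exchange_big mulr_sumr.
rewrite exchange_big /=.
apply: (@le_trans _ _ (\sum_x' V u' x' * g3^-1)); last first.
  by rewrite -mulr_suml (V_pmf u').2 mul1r.
apply: ler_sum => x' _; under eq_bigr do (under eq_bigr do rewrite mulrCA).
under eq_bigr do rewrite -mulr_sumr mulrCA.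
rewrite -mulr_sumr; apply: ler_wpM2l; first by case: (V_pmf u').
under eq_bigr do rewrite (sum_mix _ (outY M)).
rewrite (sum_mix _ condY) -(scaled_outY g3 x').
apply: ler_sum => s _; apply: ler_sum => y _; rewrite -mulrA.
by apply: ler_wpM2l; [exact: PS_ge0|apply: ind_ratio; rewrite ?outY_ge0].
Qed.

Lemma cloud_collision w k : k != cloud w ->
  \sum_cb codebook_law cb * (\sum_z outZ M (cb.2 w) z * (test_cloud (cb.1 k) z)%:R)
  <= g1^-1.
Proof.
move=> kw.
rewrite (average_other_cloud (fun x u => \sum_z outZ M x z * (test_cloud u z)%:R) kw).
rewrite exchange_big /=; under eq_bigr do under eq_bigr do rewrite mulrCA.
under eq_bigr do rewrite -mulr_sumr.
apply: average_const => // u'.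
under eq_bigr do rewrite sum_mixZ.
rewrite (sum_mixZ _ condZ).
apply: (@le_trans _ _ (\sum_z g1^-1 * condZ u' z)).
  by apply: ler_sum => z _; apply: ind_ratio; rewrite ?condZ_ge0.
rewrite -mulr_sumr exchange_big /=; under eq_bigr do rewrite -mulr_sumr sum_outZ mulr1.
by rewrite (V_pmf u').2 mulr1.
Qed.

Definition satellite_failure := \sum_u PU u * \sum_x V u x *
  \sum_s \sum_y PS M s * outY M x s y * (~~ test_satellite u x s y)%:R.

Definition pair_failure := \sum_u PU u * \sum_x V u x *
  \sum_s \sum_y PS M s * outY M x s y * (~~ test_pair x s y)%:R.

Definition cloud_failure := \sum_u PU u * \sum_x V u x *
  \sum_z outZ M x z * (~~ test_cloud u z)%:R.

Definition message_error (cb : codebook) w :=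
  \sum_s \sum_y PS M s * outY M (cb.2 w) s y * (decode cb y s != w)%:R.

Context (c1 c2 c3 : R).
Hypothesis c1_clouds : (N%:R - 1 <= c1).
Hypothesis c2_satellites :
  forall w, #|[set w' | (w' != w) && (cloud w' == cloud w)]|%:R <= c2.
Hypothesis c3_messages : m%:R - 1 <= c3.

(** Union bound: at most [c2] competitors inside the sent cloud at [g2^-1] each, and at most [c3]
    outside it at [g3^-1] each. *)
Lemma average_error w : \sum_cb codebook_law cb * message_error cb w
  <= satellite_failure + pair_failure + (c2 / g2 + c3 / g3).
Proof.
pose coll w' (cb : codebook) := \sum_s \sum_y PS M s * outY M (cb.2 w) s y *
  (if cloud w' == cloud w then test_satellite (cb.1 (cloud w)) (cb.2 w') s y
   else test_pair (cb.2 w') s y)%:R.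
pose fl (b : U -> X -> S -> Y -> bool) u x :=
  \sum_s \sum_y PS M s * outY M x s y * (~~ b u x s y)%:R.
apply: (@le_trans _ _ (\sum_cb codebook_law cb *
   (fl test_satellite (cb.1 (cloud w)) (cb.2 w)
    + fl (fun _ => test_pair) (cb.1 (cloud w)) (cb.2 w)
    + \sum_(w' | w' != w) coll w' cb))).
  apply: ler_sum => cb _; apply: ler_wpM2l; first exact: codebook_law_ge0.
  rewrite /message_error /fl /coll [X in _ <= _ + X]exchange_big -!big_split /=.
  apply: ler_sum => s _.
  rewrite [X in _ <= _ + X]exchange_big -!big_split /=; apply: ler_sum => y _.
  rewrite -mulr_sumr -!mulrDr; apply: ler_wpM2l; last exact: decode_union.
  by rewrite mulr_ge0 ?PS_ge0 ?outY_ge0.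
under eq_bigr do rewrite mulrDr mulrDr.
rewrite !big_split /= average_one (average_one w (fl (fun _ => test_pair))).
rewrite lerD2l.
under eq_bigr do rewrite mulr_sumr.
rewrite exchange_big /=.
apply: (@le_trans _ _ (\sum_(w' | w' != w)
   (if cloud w' == cloud w then g2^-1 else g3^-1))).
  apply: ler_sum => w' w'w; rewrite /coll; case: eqP => [cl|/eqP cl].
    by apply: satellite_collision => //; rewrite eq_sym.
  exact: pair_collision.
rewrite (bigID (fun w' => cloud w' == cloud w)) /=; apply: lerD.
  rewrite (eq_bigr (fun=> g2^-1)) => [|w' /andP[_ ->]] //.
  rewrite sumr_const -[leLHS]mulr_natl ler_pM2r ?invr_gt0 //.
  apply: le_trans (c2_satellites w).
  by rewrite ler_nat; apply: subset_leq_card; apply/fintype.subsetP => w'; rewrite !inE.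
rewrite (eq_bigr (fun=> g3^-1)) => [|w' /andP[_ /negbTE ->]] //.
rewrite sumr_const -[leLHS]mulr_natl ler_pM2r ?invr_gt0 //.
apply: le_trans c3_messages; rewrite lerBrDr -[X in _ + X]/(1%:R) -natrD ler_nat.
rewrite -[leqRHS]card_ord addn1 [leqRHS](cardD1 w) inE add1n ltnS.
by apply: subset_leq_card; apply/fintype.subsetP => w'; rewrite !inE => /andP[->].
Qed.

Context (kappa : S -> U -> Z -> R) (dmax : R) (dmax_ge0 : 0 <= dmax).
Hypothesis kappa_ge0 : forall s u z, 0 <= kappa s u z.
Hypothesis kappa_le : forall s u z, kappa s u z <= dmax.

Definition message_cost (cb : codebook) w :=
  \sum_s \sum_y \sum_z PS M s * chan M (cb.2 w, s) (y, z)
    * kappa s (cb.1 (sense cb z)) z.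

Definition mean_cost := \sum_u PU u * \sum_x V u x *
  \sum_s \sum_y \sum_z PS M s * chan M (x, s) (y, z) * kappa s u z.

(** If the sensing receiver finds the sent cloud, the cost is that of the true centre; otherwise it
    is at most [dmax], with a probability controlled by the cloud test. *)
Lemma average_cost w : \sum_cb codebook_law cb * message_cost cb w
  <= mean_cost + dmax * (cloud_failure + c1 / g1).
Proof.
pose cost u x := \sum_s \sum_y \sum_z PS M s * chan M (x, s) (y, z) * kappa s u z.
pose fl u x := \sum_z outZ M x z * (~~ test_cloud u z)%:R.
pose coll k (cb : codebook) := \sum_z outZ M (cb.2 w) z * (test_cloud (cb.1 k) z)%:R.
apply: (@le_trans _ _ (\sum_cb codebook_law cb *
   (cost (cb.1 (cloud w)) (cb.2 w) + dmax * (fl (cb.1 (cloud w)) (cb.2 w)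
    + \sum_(k | k != cloud w) coll k cb)))).
  apply: ler_sum => cb _; apply: ler_wpM2l; first exact: codebook_law_ge0.
  apply: (@le_trans _ _ (cost (cb.1 (cloud w)) (cb.2 w)
      + dmax * \sum_z outZ M (cb.2 w) z * (sense cb z != cloud w)%:R)).
    have -> : \sum_z outZ M (cb.2 w) z * (sense cb z != cloud w)%:R =
      \sum_s \sum_y \sum_z PS M s * chan M (cb.2 w, s) (y, z) * (sense cb z != cloud w)%:R.
      under eq_bigr do rewrite mulr_suml.
      rewrite exchange_big /=; apply: eq_bigr => s _.
      under eq_bigr do rewrite mulr_suml.
      by rewrite exchange_big.
    rewrite mulr_sumr -big_split; apply: ler_sum => s _ /=.
    rewrite mulr_sumr -big_split; apply: ler_sum => y _ /=.
    rewrite mulr_sumr -big_split; apply: ler_sum => z _ /=.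
    rewrite mulrCA -mulrDr; apply: ler_wpM2l; first by rewrite mulr_ge0 ?PS_ge0 ?chan_ge0.
    have [->|_] := eqVneq (sense cb z) (cloud w); first by rewrite mulr0 addr0.
    by rewrite mulr1 (le_trans (kappa_le _ _ _)) // lerDr.
  rewrite lerD2l; apply: ler_wpM2l => //.
  rewrite /fl /coll [X in _ <= _ + X]exchange_big -big_split /=; apply: ler_sum => z _.
  by rewrite -mulr_sumr -mulrDr; apply: ler_wpM2l; [exact: outZ_ge0|exact: sense_union].
under eq_bigr do rewrite mulrDr mulrCA mulrDr.
rewrite big_split /= average_one lerD2l -mulr_sumr; apply: ler_wpM2l => //.
rewrite big_split /= average_one lerD2l.
under eq_bigr do rewrite mulr_sumr.
rewrite exchange_big /=.
apply: (@le_trans _ _ (\sum_(k | k != cloud w) g1^-1)).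
  by apply: ler_sum => k kw; exact: cloud_collision.
rewrite sumr_const -[leLHS]mulr_natl ler_pM2r ?invr_gt0 //.
apply: le_trans c1_clouds; rewrite lerBrDr -[X in _ + X]/(1%:R) -natrD ler_nat.
rewrite -[leqRHS]card_ord addn1 [leqRHS](cardD1 (cloud w)) inE add1n ltnS.
by apply: subset_leq_card; apply/fintype.subsetP => k; rewrite !inE andbT.
Qed.

(* Weighting the error probability by lam lets one codebook be good in both
   respects. *)
Lemma good_codebook (lam : R) : 0 <= lam -> exists cb : codebook,
  lam * (\sum_w m%:R^-1 * message_error cb w) + \sum_w m%:R^-1 * message_cost cb w
  <= lam * (satellite_failure + pair_failure + (c2 / g2 + c3 / g3))
     + (mean_cost + dmax * (cloud_failure + c1 / g1)).
Proof.
move=> lam0.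
pose rhs := lam * (satellite_failure + pair_failure + (c2 / g2 + c3 / g3))
  + (mean_cost + dmax * (cloud_failure + c1 / g1)).
pose risk cb := lam * (\sum_w m%:R^-1 * message_error cb w)
  + \sum_w m%:R^-1 * message_cost cb w.
apply: contrapT => nogood.
have {nogood}bad cb : rhs < risk cb.
  by rewrite ltNge; apply/negP => ?; apply: nogood; exists cb.
have m0 : m%:R != 0 :> R by rewrite pnatr_eq0 -lt0n (leq_ltn_trans _ (ltn_ord w0)).
have [law0 law1] := codebook_law_pmf.
have : \sum_cb codebook_law cb * risk cb <= rhs.
  have -> : \sum_cb codebook_law cb * risk cb = \sum_w m%:R^-1 *
     (lam * (\sum_cb codebook_law cb * message_error cb w)
      + \sum_cb codebook_law cb * message_cost cb w).
    under [RHS]eq_bigr do rewrite mulr_sumr -big_split mulr_sumr /=.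
    rewrite exchange_big /=; apply: eq_bigr => cb _.
    rewrite /risk mulr_sumr -big_split mulr_sumr /=; apply: eq_bigr => w _; ring.
  have -> : rhs = \sum_(w < m) m%:R^-1 * rhs.
    by rewrite sumr_const card_ord -[RHS]mulr_natl mulrA mulfV ?mul1r.
  apply: ler_sum => w _; apply: ler_wpM2l; first by rewrite invr_ge0.
  apply: lerD; last exact: average_cost.
  by apply: ler_wpM2l => //; exact: average_error.
apply/negP; rewrite -ltNge -[ltLHS]mul1r -law1 mulr_suml.
(* A codebook of positive probability makes the strict bound [bad] survive averaging. *)
have [cb cb0] : exists cb, 0 < codebook_law cb.
  apply: contrapT => none; have := oner_eq0 R; rewrite -law1 big1 ?eqxx // => cb _.
  apply: contrapT => /eqP n0; apply: none; exists cb.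
  by rewrite lt_neqAle eq_sym n0 law0.
rewrite (bigD1 cb) //= [ltRHS](bigD1 cb) //=; apply: ltr_leD.
  by rewrite ltr_pM2l.
by apply: ler_sum => cb' _; apply: ler_wpM2l => //; rewrite ltW.
Qed.

End RandomCoding.

(** * Block channels and error exponents *)

Section Chernoff.
Context {R : realType}.

(** Since [expR t >= 1 + t], it suffices that the right side times [1 + t], which equals
    [1 + t ^+ 2 * (1 + 2 * t)], is at least 1. *)
Lemma expRN_le (t : R) : - 2^-1 <= t -> expR (- t) <= 1 - t + 2 * t ^+ 2.
Proof.
move=> t2; rewrite expRN.
have e1 : 1 + t <= expR t by exact: expR_ge1Dx.
have pos : 0 < 1 + t by lra.
apply: (@le_trans _ _ (1 + t)^-1); first by rewrite lef_pV2 ?posrE ?expR_gt0.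
rewrite -[leLHS]mul1r ler_pdivrMr //.
have : 0 <= t ^+ 2 * (1 + 2 * t) by rewrite mulr_ge0 ?sqr_ge0 //; lra.
by rewrite expr2; nra.
Qed.

(** Exponential Markov inequality for the shifted variable [g], whose mean [d] is positive. *)
Lemma chernoff (T : finType) (p f : T -> R) (c : R) : is_pmf p ->
  c < \sum_t p t * f t ->
  exists2 rho : R, 0 < rho < 1 & forall n,
    \sum_(t : {ffun 'I_n -> T}) (\prod_i p (t i)) * (\sum_i f (t i) < n%:R * c)%R%:R
    <= rho ^+ n.
Proof.
move=> [p0 p1] cf.
pose g t := f t - c; pose d := \sum_t p t * g t.
have dE : d = \sum_t p t * f t - c.
  by rewrite /d /g; under eq_bigr do rewrite mulrBr; rewrite sumrB -mulr_suml p1 mul1r.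
have d0 : 0 < d by rewrite dE subr_gt0.
pose K := 1 + \sum_t `|g t|.
have K1 : 1 <= K by rewrite lerDl sumr_ge0.
have gK t : `|g t| <= K.
  by rewrite /K (bigD1 t) //= addrCA lerDl addr_ge0 ?sumr_ge0.
have dK : d <= K.
  rewrite -[leRHS]mul1r -p1 mulr_suml; apply: ler_sum => t _.
  by apply: ler_wpM2l => //; apply: le_trans (ler_norm _) (gK t).
have K0 : 0 < K by lra.
pose q := d / K.
have q0 : 0 < q by rewrite divr_gt0.
have q1 : q <= 1 by rewrite /q ler_pdivrMr // mul1r.
(* With this choice [lam * K = q / 4] is at most 1/2, so the quadratic bound on the exponential
   applies; it gives [1 - q ^+ 2 / 4 + q ^+ 2 / 8], which is [rho]. *)
pose lam := q / (4 * K).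
have lam0 : 0 < lam by apply: divr_gt0 => //; apply: mulr_gt0.
pose rho := 1 - q ^+ 2 / 8.
have rhoP : \sum_t p t * expR (- (lam * g t)) <= rho.
  apply: (@le_trans _ _ (\sum_t p t * (1 - lam * g t + 2 * (lam * K) ^+ 2))).
    apply: ler_sum => t _; apply: ler_wpM2l => //.
    have lg : `|lam * g t| <= lam * K.
      by rewrite normrM gtr0_norm // ler_pM2l.
    have lK : lam * K = q / 4 by rewrite /lam; field; rewrite gt_eqF.
    apply: le_trans (expRN_le _) _.
      by move: lg; rewrite ler_norml lK => /andP[? _]; lra.
    rewrite lerD2l ler_pM2l // -[leLHS]real_normK ?num_real //.
    by rewrite lerXn2r ?nnegrE // mulr_ge0 // ltW.
  under eq_bigr do rewrite mulrDr mulrBr mulr1 mulrCA.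
  rewrite big_split sumrB /= -mulr_sumr -mulr_suml p1 mul1r -/d.
  have -> : lam * d = q ^+ 2 / 4 by rewrite /lam /q; field; rewrite gt_eqF.
  have -> : lam * K = q / 4 by rewrite /lam; field; rewrite gt_eqF.
  have -> : (q / 4) ^+ 2 = q ^+ 2 / 16 by field.
  by rewrite /rho; lra.
have q2 : q ^+ 2 <= 1 by rewrite expr_le1 // ltW.
have q20 := exprn_gt0 2 q0.
exists rho; first by rewrite /rho; apply/andP; split; lra.
move=> n.
apply: (@le_trans _ _ (\sum_(t : {ffun 'I_n -> T})
    \prod_i (p (t i) * expR (- (lam * g (t i)))))).
  apply: ler_sum => t _; rewrite big_split /=.
  apply: ler_wpM2l; first by apply: prodr_ge0.
  have -> : \prod_i expR (- (lam * g (t i))) = expR (- (lam * \sum_i g (t i))).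
    by rewrite -expR_sum; congr expR; rewrite mulr_sumr -sumrN.
  apply: ind_le; first exact: expR_ge0.
  move=> lt; rewrite -expR0 ler_expR oppr_ge0 pmulr_rle0 //.
  by rewrite /g sumrB sumr_const card_ord -mulr_natl subr_le0 ltW.
rewrite (sum_prod_ffun (fun _ t => p t * expR (- (lam * g t)))) prodr_const card_ord.
apply: lerXn2r => //; rewrite ?nnegrE.
  by apply: sumr_ge0 => t _; rewrite mulr_ge0 ?expR_ge0.
by apply: le_trans rhoP; apply: sumr_ge0 => t _; rewrite mulr_ge0 ?expR_ge0.
Qed.

Lemma likelihood_failure (T : finType) (p a b : T -> R) (c : R) : is_pmf p ->
  (forall t, 0 < p t -> 0 < a t /\ 0 < b t) ->
  c < \sum_t p t * (ln (a t) - ln (b t)) ->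
  exists2 rho : R, 0 < rho < 1 & forall n,
    \sum_(t : {ffun 'I_n -> T}) (\prod_i p (t i)) *
      (~~ (expR (n%:R * c) * \prod_i b (t i) <= \prod_i a (t i)))%R%:R <= rho ^+ n.
Proof.
move=> ppmf ab /(chernoff ppmf)[rho rho01 H]; exists rho => // n.
apply: le_trans (H n); apply: ler_sum => t _.
have pp0 : 0 <= \prod_i p (t i) by apply: prodr_ge0 => i _; case: ppmf.
have [->|/eqP pp] := eqVneq (\prod_i p (t i)) 0; first by rewrite !mul0r.
apply: ler_wpM2l => //; apply: ind_le => //.
have pos i : 0 < p (t i).
  apply: (prod_gt0 (F := fun i => p (t i))) => [j|]; first by case: ppmf.
  by rewrite lt_neqAle eq_sym pp0 andbT; apply/eqP.
have a0 i : 0 < a (t i) by case: (ab _ (pos i)).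
have b0 i : 0 < b (t i) by case: (ab _ (pos i)).
rewrite -ltNge => lt; rewrite (_ : _ < _ = true) //.
rewrite sumrB -!ln_prod // ltrBlDr -[X in _ < X + _](expRK (n%:R * c)).
by rewrite -lnM ?posrE ?expR_gt0 ?prodr_gt0 // ltr_ln ?posrE ?mulr_gt0 ?expR_gt0 ?prodr_gt0.
Qed.

End Chernoff.

Section BlockChannel.
Context {R : realType} {X S Y Z Shat : finType} (M : bistatic R X S Y Z Shat).
Context {U : finType} (PU : U -> R) (V : U -> X -> R) (n : nat).
Hypotheses (PU_pmf : is_pmf PU) (V_pmf : forall u, is_pmf (V u)).

Local Notation Un := {ffun 'I_n -> U}.
Local Notation Xn := {ffun 'I_n -> X}.
Local Notation Sn := {ffun 'I_n -> S}.
Local Notation Yn := {ffun 'I_n -> Y}.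
Local Notation Zn := {ffun 'I_n -> Z}.

Definition block_chan (xs : Xn * Sn) (yz : Yn * Zn) : R :=
  \prod_i chan M (xs.1 i, xs.2 i) (yz.1 i, yz.2 i).

Lemma block_chan_pmf xs : is_pmf (block_chan xs).
Proof.
split=> [yz|]; first by apply: prodr_ge0 => i _; exact: chan_ge0.
rewrite sum_pair sum_ffun_pair /=.
have [_ <-] := prod_pmf (fun i : 'I_n => chan_pmf M (xs.1 i, xs.2 i)).
by apply: eq_bigr => t _; apply: eq_bigr => i _; rewrite !ffunE -surjective_pairing.
Qed.

(** The n-fold product as a channel of its own, so that the one-shot bounds apply to blocks. Its
    distortion is a dummy: the actual cost is passed separately as [kappa], since it involves the
    cloud centre. *)
Definition block_channel : bistatic R Xn Sn Yn Zn unit :=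
  @Bistatic R Xn Sn Yn Zn unit (fun s => \prod_i PS M (s i)) block_chan (fun _ _ => 0)
    (prod_pmf (fun _ : 'I_n => PS_pmf M)) block_chan_pmf (fun _ _ => lexx 0).

Definition block_PU (u : Un) := \prod_i PU (u i).
Definition block_V (u : Un) (x : Xn) := \prod_i V (u i) (x i).

Lemma block_PU_pmf : is_pmf block_PU.
Proof. exact: (prod_pmf (fun _ : 'I_n => PU_pmf)). Qed.

Lemma block_V_pmf u : is_pmf (block_V u).
Proof. exact: (prod_pmf (fun i => V_pmf (u i))). Qed.

Lemma block_outY x s y : outY block_channel x s y = \prod_i outY M (x i) (s i) (y i).
Proof. by rewrite -(sum_prod_ffun (fun i z => chan M (x i, s i) (y i, z))). Qed.

Lemma block_outZ x z : outZ block_channel x z = \prod_i outZ M (x i) (z i).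
Proof.
rewrite /outZ sum_ffun_pair.
under [RHS]eq_bigr do rewrite pair_bigA /=.
rewrite -(sum_prod_ffun (fun i (sy : S * Y) => PS M sy.1 * chan M (x i, sy.1) (sy.2, z i))).
apply: eq_bigr => t _; rewrite -big_split; apply: eq_bigr => i _.
by rewrite /= !ffunE.
Qed.

Lemma block_condY u s y : condY block_channel block_V u s y
  = \prod_i condY M V (u i) (s i) (y i).
Proof.
rewrite -(sum_prod_ffun (fun i x => V (u i) x * outY M x (s i) (y i))).
by apply: eq_bigr => x _; rewrite block_outY -big_split.
Qed.

Lemma block_condZ u z : condZ block_channel block_V u z = \prod_i condZ M V (u i) (z i).
Proof.
rewrite -(sum_prod_ffun (fun i x => V (u i) x * outZ M x (z i))).
by apply: eq_bigr => x _; rewrite block_outZ -big_split.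
Qed.

Lemma block_mixY s y : mixY block_channel block_PU block_V s y
  = \prod_i mixY M PU V (s i) (y i).
Proof.
rewrite -(sum_prod_ffun (fun i u => PU u * condY M V u (s i) (y i))).
by apply: eq_bigr => u _; rewrite block_condY -big_split.
Qed.

Lemma block_mixZ z : mixZ block_channel block_PU block_V z
  = \prod_i mixZ M PU V (z i).
Proof.
rewrite -(sum_prod_ffun (fun i u => PU u * condZ M V u (z i))).
by apply: eq_bigr => u _; rewrite block_condZ -big_split.
Qed.

(** Four blocks become one block of quadruples, whose letters are i.i.d. under the product law. *)
Lemma sum_ffun_quad (T1 T2 T3 T4 : finType)
    (F : {ffun 'I_n -> T1} -> {ffun 'I_n -> T2} -> {ffun 'I_n -> T3} -> {ffun 'I_n -> T4} -> R) :
  \sum_a \sum_b \sum_c \sum_d F a b c d =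
  \sum_(t : {ffun 'I_n -> T1 * (T2 * (T3 * T4))})
    F [ffun i => (t i).1] [ffun i => (t i).2.1] [ffun i => (t i).2.2.1] [ffun i => (t i).2.2.2].
Proof.
under eq_bigr do (under eq_bigr do rewrite sum_ffun_pair).
under eq_bigr do rewrite sum_ffun_pair.
rewrite sum_ffun_pair; apply: eq_bigr => t _.
by congr F; apply/ffunP => i; rewrite !ffunE.
Qed.

Definition input_output_law (o : U * (X * (S * Y))) : R :=
  PU o.1 * (V o.1 o.2.1 * (PS M o.2.2.1 * outY M o.2.1 o.2.2.1 o.2.2.2)).

Lemma input_output_pmf : is_pmf input_output_law.
Proof.
split=> [o|].
  rewrite mulr_ge0 ?mulr_ge0 ?PS_ge0 ?outY_ge0 //; first by case: PU_pmf.
  by case: (V_pmf o.1).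
rewrite sum_pair -[RHS]PU_pmf.2; apply: eq_bigr => u _.
rewrite /input_output_law /= -mulr_sumr.
rewrite sum_pair (_ : \sum_b _ = 1) ?mulr1 // -[RHS](V_pmf u).2.
apply: eq_bigr => x _.
rewrite /= -mulr_sumr sum_pair /= -[RHS]mulr1; congr (_ * _).
rewrite -[RHS](sum_PS M); apply: eq_bigr => s _.
by rewrite -mulr_sumr sum_outY mulr1.
Qed.

Lemma sum_block_input_output (t : Un -> Xn -> Sn -> Yn -> R) :
  \sum_u block_PU u * \sum_x block_V u x *
    \sum_s \sum_y PS block_channel s * outY block_channel x s y * t u x s y
  = \sum_(o : {ffun 'I_n -> U * (X * (S * Y))})
    (\prod_i input_output_law (o i)) *
      t [ffun i => (o i).1] [ffun i => (o i).2.1] [ffun i => (o i).2.2.1] [ffun i => (o i).2.2.2].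
Proof.
transitivity (\sum_u \sum_x \sum_s \sum_y block_PU u * (block_V u x *
    (PS block_channel s * outY block_channel x s y * t u x s y))).
  apply: eq_bigr => u _; rewrite mulr_sumr; apply: eq_bigr => x _.
  rewrite mulrA mulr_sumr; apply: eq_bigr => s _; rewrite mulr_sumr.
  by apply: eq_bigr => y _; rewrite -[LHS]mulrA.
rewrite sum_ffun_quad; apply: eq_bigr => o _.
rewrite !mulrA; congr (_ * _); rewrite block_outY -!big_split; apply: eq_bigr => i _.
by rewrite /input_output_law /= !ffunE !mulrA.
Qed.

Definition cloud_law (o : U * Z) : R := PU o.1 * condZ M V o.1 o.2.

Lemma cloud_law_pmf : is_pmf cloud_law.
Proof.
split=> [o|]; first by rewrite mulr_ge0 ?condZ_ge0 //; case: PU_pmf.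
rewrite sum_pair -[RHS]PU_pmf.2; apply: eq_bigr => u _.
rewrite /cloud_law /= -mulr_sumr exchange_big /=.
under eq_bigr do rewrite -mulr_sumr sum_outZ mulr1.
by rewrite (V_pmf u).2 mulr1.
Qed.

Lemma block_satellite_failure g :
  satellite_failure block_channel block_PU block_V g
  = \sum_(o : {ffun 'I_n -> U * (X * (S * Y))}) (\prod_i input_output_law (o i)) *
    (~~ (g * \prod_i condY M V (o i).1 (o i).2.2.1 (o i).2.2.2
         <= \prod_i outY M (o i).2.1 (o i).2.2.1 (o i).2.2.2))%R%:R.
Proof.
rewrite /satellite_failure (sum_block_input_output (fun u x s y =>
  (~~ test_satellite block_channel block_V g u x s y)%:R)).
apply: eq_bigr => o _; congr (_ * (~~ _)%:R).
rewrite /test_satellite block_condY block_outY; congr (_ * _ <= _);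
  by apply: eq_bigr => i _; rewrite !ffunE.
Qed.

Lemma block_pair_failure g :
  pair_failure block_channel block_PU block_V g
  = \sum_(o : {ffun 'I_n -> U * (X * (S * Y))}) (\prod_i input_output_law (o i)) *
    (~~ (g * \prod_i mixY M PU V (o i).2.2.1 (o i).2.2.2
         <= \prod_i outY M (o i).2.1 (o i).2.2.1 (o i).2.2.2))%R%:R.
Proof.
rewrite /pair_failure (sum_block_input_output (fun _ x s y =>
  (~~ test_pair block_channel block_PU block_V g x s y)%:R)).
apply: eq_bigr => o _; congr (_ * (~~ _)%:R).
rewrite /test_pair block_mixY block_outY; congr (_ * _ <= _);
  by apply: eq_bigr => i _; rewrite !ffunE.
Qed.

Lemma block_cloud_failure g :
  cloud_failure block_channel block_PU block_V g
  = \sum_(o : {ffun 'I_n -> U * Z}) (\prod_i cloud_law (o i)) *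
    (~~ (g * \prod_i mixZ M PU V (o i).2 <= \prod_i condZ M V (o i).1 (o i).2))%R%:R.
Proof.
rewrite /cloud_failure.
under eq_bigr do rewrite (sum_mixZ _ (outZ block_channel)) mulr_sumr.
rewrite sum_ffun_pair; apply: eq_bigr => o _; rewrite mulrA; congr (_ * (~~ _)%:R).
  rewrite -[\sum_a _]/(condZ block_channel block_V _ _) block_condZ -big_split.
  by apply: eq_bigr => i _; rewrite /= !ffunE.
rewrite /test_cloud block_condZ block_mixZ; congr (_ * _ <= _);
  by apply: eq_bigr => i _; rewrite !ffunE.
Qed.

Context (kappa : S -> U -> Z -> R).

Definition block_cost (s : Sn) (u : Un) (z : Zn) : R :=
  n%:R^-1 * \sum_i kappa (s i) (u i) (z i).

Definition transmission_law (o : U * (X * (S * (Y * Z)))) : R :=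
  let: (u, (x, (s, (y, z)))) := o in
  PU u * (V u x * (PS M s * chan M (x, s) (y, z))).

Lemma mean_costE : mean_cost M PU V kappa = \sum_o transmission_law o *
  (let: (u, (x, (s, (y, z)))) := o in kappa s u z).
Proof.
rewrite sum_pair; apply: eq_bigr => u _; rewrite sum_pair mulr_sumr.
apply: eq_bigr => x _; rewrite sum_pair mulrA mulr_sumr.
apply: eq_bigr => s _; rewrite sum_pair mulr_sumr.
apply: eq_bigr => y _; rewrite mulr_sumr; apply: eq_bigr => z _.
by rewrite /= !mulrA.
Qed.

Lemma transmission_pmf : is_pmf transmission_law.
Proof.
split=> [[u [x [s [y z]]]]|].
  rewrite /= mulr_ge0 ?mulr_ge0 ?PS_ge0 ?chan_ge0 //; first by case: PU_pmf.
  by case: (V_pmf u).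
rewrite sum_pair -[RHS]PU_pmf.2; apply: eq_bigr => u _.
rewrite /= -[RHS]mulr1 -(V_pmf u).2 mulr_sumr sum_pair.
apply: eq_bigr => x _; rewrite -[RHS]mulr1 -(sum_PS M) mulr_sumr sum_pair.
apply: eq_bigr => s _; rewrite -[RHS]mulr1 -(sum_chan M x s) mulr_sumr sum_pair.
apply: eq_bigr => y _; rewrite mulr_sumr; apply: eq_bigr => z _.
by rewrite /= !mulrA.
Qed.

(** The block cost averages n terms of equal mean. At n = 0 the left side would be 0, because
    [0^-1 = 0]. *)
Lemma block_mean_cost : (0 < n)%N ->
  mean_cost block_channel block_PU block_V block_cost = mean_cost M PU V kappa.
Proof.
move=> n0.
transitivity (\sum_u \sum_x \sum_s \sum_y \sum_z block_PU u * (block_V u x *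
    (PS block_channel s * block_chan (x, s) (y, z) * block_cost s u z))).
  apply: eq_bigr => u _; rewrite mulr_sumr; apply: eq_bigr => x _.
  rewrite mulrA mulr_sumr; apply: eq_bigr => s _; rewrite mulr_sumr.
  apply: eq_bigr => y _; rewrite mulr_sumr.
  by apply: eq_bigr => z _; rewrite -[LHS]mulrA.
transitivity (\sum_(t : {ffun 'I_n -> U * (X * (S * (Y * Z)))})
   (\prod_i transmission_law (t i)) * (n%:R^-1 * \sum_i
     (let: (u, (x, (s, (y, z)))) := t i in kappa s u z))).
  rewrite (eq_bigr (fun u => \sum_x \sum_s \sum_(yz : {ffun 'I_n -> Y * Z})
    block_PU u * (block_V u x * (PS block_channel s
      * block_chan (x, s) ([ffun i => (yz i).1], [ffun i => (yz i).2])
      * block_cost s u [ffun i => (yz i).2])))); last first.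
    move=> u _; apply: eq_bigr => x _; apply: eq_bigr => s _.
    by rewrite sum_ffun_pair.
  rewrite sum_ffun_quad; apply: eq_bigr => t _; rewrite !mulrA.
  rewrite -!mulrA [X in _ * (_ * (_ * (_ * X)))](_ : _ = n%:R^-1 * \sum_i
     (let: (u, (x, (s, (y, z)))) := t i in kappa s u z)); last first.
    congr (_ * _); apply: eq_bigr => i _; rewrite !ffunE.
    by case: (t i) => [u [x [s [y z]]]].
  rewrite !mulrA; congr (_ * _ * _); rewrite -!big_split; apply: eq_bigr => i _.
  by rewrite /= !ffunE; case: (t i) => [u [x [s [y z]]]]; rewrite /= !mulrA.
under eq_bigr do rewrite mulrCA mulr_sumr.
rewrite -mulr_sumr exchange_big /=.
under eq_bigr => i _ do rewrite (sum_ffun1 (P := fun _ => transmission_law) i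
  (fun o => let: (u, (x, (s, (y, z)))) := o in kappa s u z)
  (fun _ => transmission_pmf.2)) -mean_costE.
by rewrite sumr_const card_ord -[X in _ * X]mulr_natl mulKf // pnatr_eq0 -lt0n.
Qed.

End BlockChannel.

(** * From codebooks to codes *)

Section CodeOfCodebook.
Context {R : realType} {X S Y Z Shat : finType} (M : bistatic R X S Y Z Shat).
Context {U : finType} (PU : U -> R) (V : U -> X -> R) (n N m : nat).
Context (g1 g2 g3 : R) (cloud : 'I_m -> 'I_N) (k0 : 'I_N) (w0 : 'I_m).
Context (h : U -> Z -> Shat).

Local Notation Mn := (block_channel M n).
Local Notation PUn := (@block_PU R U PU n).
Local Notation Vn := (@block_V R X U V n).
Local Notation dec := (decode Mn PUn Vn g2 g3 cloud w0).
Local Notation sens := (sense Mn PUn Vn g1 k0).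

Definition code_of (cb : codebook) : Defs.code X S Y Z Shat m n :=
  Code (fun w => cb.2 w) (fun y s => dec cb y s)
    (fun z => [ffun i => h (cb.1 (sens cb z) i) (z i)]).

Lemma error_code_of cb : error_prob M (code_of cb)
  = \sum_w m%:R^-1 * message_error Mn PUn Vn g2 g3 cloud w0 cb w.
Proof.
rewrite /error_prob /prob big_mkcond sum_block; apply: eq_bigr => w _.
rewrite mulr_sumr; apply: eq_bigr => s _; rewrite mulr_sumr; apply: eq_bigr => y _.
rewrite /outY mulr_sumr mulr_suml mulr_sumr; apply: eq_bigr => z _ /=.
by case: (_ != _); rewrite /= ?mulr1 ?mulr0 // /block_chan /= mulrA.
Qed.

Lemma distortion_code_of cb : distortion M (code_of cb)
  = \sum_w m%:R^-1 * message_cost Mn PUn Vn g1 k0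
      (block_cost (fun s u z => dist M s (h u z))) cb w.
Proof.
transitivity (\sum_o block_law M (code_of cb) o * (n%:R^-1 * \sum_i
   (let: (w, s, y, z) := o in dist M (s i) (estimator (code_of cb) z i)))).
  under eq_bigr do rewrite mulrCA mulr_sumr.
  rewrite -mulr_sumr exchange_big /distortion /expect /=; congr (_ * _).
rewrite sum_block; apply: eq_bigr => w _.
rewrite /message_cost; do 3 (rewrite mulr_sumr; apply: eq_bigr => ? _).
rewrite /= -!mulrA; do 4 congr (_ * _).
by apply: eq_bigr => i _; rewrite ffunE.
Qed.

End CodeOfCodebook.

(** * The number of messages and their division into clouds *)

Section MessageCount.
Context {R : realType}.
Implicit Types (r : R) (n : nat).

Lemma powR2E r n : 2 `^ (n%:R * r) = expR (n%:R * (r * ln 2)).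
Proof. by rewrite /powR pnatr_eq0 /= mulrA. Qed.

Lemma msg_card_natr r n : (msg_card r n)%:R = (Num.ceil (expR (n%:R * (r * ln 2))))%:~R :> R.
Proof.
rewrite /msg_card powR2E natr_absz ger0_norm //.
by rewrite ceil_ge0 (lt_trans _ (expR_gt0 _)) // ltrN10.
Qed.

Lemma msg_card_ge r n : expR (n%:R * (r * ln 2)) <= (msg_card r n)%:R.
Proof. by rewrite msg_card_natr ceil_ge. Qed.

Lemma msg_card_lt r n : (msg_card r n)%:R - 1 <= expR (n%:R * (r * ln 2)).
Proof.
rewrite msg_card_natr ltW // (_ : _ - 1 = (Num.ceil (expR (n%:R * (r * ln 2))) - 1)%:~R).
  exact: ceilB1_lt.
by rewrite intrD.
Qed.

Lemma msg_card_gt0 r n : (0 < msg_card r n)%N.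
Proof.
have := msg_card_ge r n; case: (msg_card r n) => //.
by move=> /(lt_le_trans (expR_gt0 _)); rewrite ltxx.
Qed.

Lemma msg_card_le r n k : expR (n%:R * (r * ln 2)) <= k%:R -> (msg_card r n <= k)%N.
Proof.
by move=> le; rewrite -(ler_nat R) msg_card_natr -[k%:R]/((k%:Z)%:~R) ler_int ceil_le_int.
Qed.

(** The quotient by [l.+1] names the cloud. Within a cloud the remainders are distinct, and that of
    [w] is excluded, hence [l] instead of [l.+1]. *)
Lemma cloud_partition (m k l : nat) : (m <= k.+1 * l.+1)%N ->
  exists cloud : 'I_m -> 'I_k.+1,
    forall w, (#|[set w' | (w' != w) && (cloud w' == cloud w)]| <= l)%N.
Proof.
move=> mkl; exists (fun w => inord (w %/ l.+1)) => w.
have lt (w' : 'I_m) : (w' %/ l.+1 < k.+1)%N.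
  by rewrite ltn_divLR // (leq_trans (ltn_ord w')).
pose f (w' : 'I_m) : 'I_l.+1 := inord (w' %% l.+1).
have fE w' : nat_of_ord (f w') = (w' %% l.+1)%N by rewrite inordK // ltn_mod.
set A := [set _ | _].
have Aeq w' : w' \in A -> (w' %/ l.+1 = w %/ l.+1)%N.
  rewrite inE => /andP[_ /eqP/(congr1 val)] /=.
  by rewrite !inordK.
have finj : {in A &, injective f}.
  move=> a b /Aeq qa /Aeq qb /(congr1 val) /=; rewrite !fE => ab.
  by apply: val_inj; rewrite /= (divn_eq a l.+1) (divn_eq b l.+1) qa qb ab.
rewrite -(card_in_imset finj) -[leqRHS](_ : #|[set~ f w]| = l); last first.
  by rewrite cardsC1 card_ord.
apply: subset_leq_card; apply/fintype.subsetP => _ /imsetP[w' w'A ->].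
rewrite !inE; apply: contraTneq (w'A) => /(congr1 val) /=; rewrite !fE => eqm.
rewrite inE negb_and; apply/orP; left; rewrite negbK; apply/eqP; apply: val_inj.
by rewrite /= (divn_eq w' l.+1) (divn_eq w l.+1) (Aeq _ w'A) eqm.
Qed.

End MessageCount.

(** * Informations of a superposition law *)

Section Superposition.
Context {R : realType} {X S Y Z Shat : finType} (M : bistatic R X S Y Z Shat).
Context {U : finType}.

(** Where p(u) = 0 the conditional law is undetermined; the point mass at [x0] keeps [V u] a pmf for
    every [u]. *)
Lemma disintegration (P : U * X -> R) (x0 : X) : is_pmf P ->
  exists PU : U -> R, exists V : U -> X -> R,
    [/\ is_pmf PU, forall u, is_pmf (V u) & P = fun ux => PU ux.1 * V ux.1 ux.2].
Proof.
move=> [P0 P1]; have P_ge0 u x : 0 <= P (u, x) by [].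
exists (margU P), (fun u x => if margU P u == 0 then (x == x0)%:R else P (u, x) / margU P u).
split.
- by split=> [u|]; [exact: margU_ge0|rewrite -P1 sum_pair].
- move=> u; have [u0|u0] := eqVneq (margU P u) 0; split=> [x|] //.
  + by under eq_bigr do rewrite -[_%:R]mulr1; rewrite (sum_delta _ (fun=> 1)).
  + by rewrite mulr_ge0 ?invr_ge0 ?margU_ge0.
  + by rewrite -mulr_suml mulfV.
- apply/funext => -[u x] /=; have [u0|u0] := eqVneq (margU P u) 0; last by rewrite mulrC divfK.
  by rewrite u0 mul0r; move/psumr_eq0P: u0 => ->.
Qed.

Context (PU : U -> R) (V : U -> X -> R).
Hypotheses (PU_pmf : is_pmf PU) (V_pmf : forall u, is_pmf (V u)).

Let P (ux : U * X) := PU ux.1 * V ux.1 ux.2.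

Lemma PV_ge0 u x : 0 <= P (u, x).
Proof. by rewrite mulr_ge0 //; [case: PU_pmf|case: (V_pmf u)]. Qed.

Lemma PV_pmf : is_pmf P.
Proof.
split=> [[u x]|]; first exact: PV_ge0.
rewrite sum_pair -[RHS]PU_pmf.2; apply: eq_bigr => u _.
by rewrite /P /= -mulr_sumr (V_pmf u).2 mulr1.
Qed.

Lemma jointY_cond u s y : jointY M P u s y = PU u * condY M V u s y.
Proof. by rewrite /condY mulr_sumr; apply: eq_bigr => x _; rewrite /P mulrA. Qed.

Lemma jointZ_cond u z : jointZ M P u z = PU u * condZ M V u z.
Proof. by rewrite /condZ mulr_sumr; apply: eq_bigr => x _; rewrite /P mulrA. Qed.

Lemma margZ_mix z : margZ M P z = mixZ M PU V z.
Proof. by apply: eq_bigr => u _; rewrite jointZ_cond. Qed.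

Lemma mean_cost_distortion (h : U -> Z -> Shat) :
  mean_cost M PU V (fun s u z => dist M s (h u z)) = aux_distortion M P h.
Proof.
rewrite aux_distortion_cost; apply: eq_bigr => u _; rewrite mulr_sumr.
by apply: eq_bigr => x _; rewrite mulrA.
Qed.

(** In nats, the three quantities are I(U;Z), I(X;Y|U,S) and I(U,X;Y|S), the exponents available to
    the cloud, satellite and pair tests. *)
Definition cloud_info := \sum_o cloud_law M PU V o *
  (ln (condZ M V o.1 o.2) - ln (mixZ M PU V o.2)).

Definition satellite_info := \sum_o input_output_law M PU V o *
  (ln (outY M o.2.1 o.2.2.1 o.2.2.2) - ln (condY M V o.1 o.2.2.1 o.2.2.2)).

Definition pair_info := \sum_o input_output_law M PU V o *
  (ln (outY M o.2.1 o.2.2.1 o.2.2.2) - ln (mixY M PU V o.2.2.1 o.2.2.2)).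

Lemma sum_joint_cloud (f : U -> Z -> R) :
  \sum_o joint_law M P o * f (rvU o) (rvZ o) = \sum_o cloud_law M PU V o * f o.1 o.2.
Proof.
rewrite -(sum_law (joint_law M P) (rvpair rvU rvZ) (fun uz => f uz.1 uz.2)).
by apply: eq_bigr => -[u z] _; rewrite law_UZ jointZ_cond.
Qed.

Lemma sum_joint_input_output (f : U -> X -> S -> Y -> R) :
  \sum_o joint_law M P o * f (rvU o) (rvX o) (rvS o) (rvY o)
  = \sum_o input_output_law M PU V o * f o.1 o.2.1 o.2.2.1 o.2.2.2.
Proof.
rewrite sum_joint exchange_big sum_pair; apply: eq_bigr => u _ /=.
rewrite exchange_big sum_pair; apply: eq_bigr => x _ /=; rewrite sum_pair.
apply: eq_bigr => s _; apply: eq_bigr => y _.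
by rewrite -mulr_suml -mulr_sumr /input_output_law /P /outY /= !mulrA.
Qed.

Lemma aux_rate_split : aux_rate M P * ln 2 = satellite_info + cloud_info.
Proof.
rewrite aux_rate_density; last exact: PV_ge0.
rewrite /satellite_info /cloud_info.
rewrite -(sum_joint_input_output (fun u x s y => ln (outY M x s y) - ln (condY M V u s y))).
rewrite -(sum_joint_cloud (fun u z => ln (condZ M V u z) - ln (mixZ M PU V z))).
rewrite -big_split; apply: eq_bigr => -[[[[s u] x] y] z] _ /=.
have [->|J0] := eqVneq (P (u, x) * PS M s * chan M (x, s) (y, z)) 0.
  by rewrite !mul0r addr0.
have /(joint_gt0 PV_ge0)[Pp Sp cp] : 0 < joint_law M P (s, u, x, y, z).
  by rewrite lt_neqAle eq_sym J0 joint_ge0 //; exact: PV_ge0.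
rewrite -mulrDr; congr (_ * _); rewrite margZ_mix jointY_cond jointZ_cond.
have Y0 := jointY_gt0 PV_ge0 Pp (outY_gt0 cp).
have Z0 := jointZ_gt0 PV_ge0 Pp (outZ_gt0 Sp cp).
have [U0 _] : 0 < PU u /\ 0 < V u x.
  by apply: mulr_gt0_split Pp; [case: PU_pmf|case: (V_pmf u)].
move: Y0 Z0; rewrite jointY_cond jointZ_cond !pmulr_rgt0 // => Y0 Z0.
by rewrite !lnM ?posrE //; ring.
Qed.

Context (Q : Y -> Z -> R) (Q_pmf : forall y, is_pmf (Q y)).
Hypothesis markov : forall x s y z, chan M (x, s) (y, z) = outY M x s y * Q y z.

(* I(X;Y|U,S) + I(U;Z) <= I(U,X;Y|S): the communication receiver can decode the
   cloud center as well, its output being less noisy than Z. *)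
Lemma info_le : satellite_info + cloud_info <= pair_info.
Proof.
(* The joint law tilted by p(z|u)/p(z) and p(y|s)/p(y|u,s). The mean of its log-ratio to the joint
   law is exactly the difference to be bounded, so the Gibbs inequality concludes. *)
pose r (o : S * U * X * Y * Z) : R := let: (s, u, x, y, z) := o in
  P (u, x) * PS M s * chan M (x, s) (y, z) * (condZ M V u z / mixZ M PU V z)
  * (mixY M PU V s y / condY M V u s y).
have cY0 u s y := condY_ge0 M V_pmf u s y.
have cZ0 u z := condZ_ge0 M V_pmf u z.
have mY0 s y := mixY_ge0 M PU_pmf V_pmf s y.
have mZ0 z := mixZ_ge0 M PU_pmf V_pmf z.
have PU0 u : 0 <= PU u by case: PU_pmf.
have r0 o : 0 <= r o.
  case: o => [[[[s u] x] y] z]; rewrite /r.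
  do 2 (apply: mulr_ge0; last by apply: mulr_ge0; rewrite ?invr_ge0).
  exact: (joint_ge0 M PV_ge0 (s, u, x, y, z)).
have pos s u x y z : 0 < joint_law M P (s, u, x, y, z) ->
  [/\ 0 < condZ M V u z, 0 < mixZ M PU V z, 0 < mixY M PU V s y,
      0 < condY M V u s y & 0 < outY M x s y].
  move=> /(joint_gt0 PV_ge0)[Pp Sp cp].
  have [U0 V0] : 0 < PU u /\ 0 < V u x.
    by apply: mulr_gt0_split Pp; [case: PU_pmf|case: (V_pmf u)].
  have Y0 := jointY_gt0 PV_ge0 Pp (outY_gt0 cp).
  have Z0 := jointZ_gt0 PV_ge0 Pp (outZ_gt0 Sp cp).
  have MZ := margZ_gt0 PV_ge0 Z0.
  move: Y0 Z0 MZ; rewrite margZ_mix jointY_cond jointZ_cond !pmulr_rgt0 // => Y0 Z0 MZ.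
  split=> //; last exact: outY_gt0 cp.
  by apply: (sum_gt0 (a := u)) => [u'|]; rewrite ?mulr_ge0 // mulr_gt0.
(* Summing over x cancels p(y|u,s); summing then over s and y cancels p(z) by the Markov property,
   leaving at most the law of (U, Z). *)
have r1 : \sum_o r o <= 1.
  apply: (@le_trans _ _ (\sum_u \sum_z PU u * (condZ M V u z / mixZ M PU V z)
      * \sum_s \sum_y PS M s * mixY M PU V s y * Q y z)).
    rewrite sum_joint [leLHS]exchange_big /=; apply: ler_sum => u _.
    under [leRHS]eq_bigr do rewrite mulr_sumr.
    rewrite [leRHS]exchange_big /=; apply: ler_sum => s _.
    under [leRHS]eq_bigr do rewrite mulr_sumr.
    rewrite [leRHS]exchange_big [leLHS]exchange_big /=; apply: ler_sum => y _.
    rewrite [leLHS]exchange_big /=; apply: ler_sum => z _.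
    have -> : \sum_x P (u, x) * PS M s * chan M (x, s) (y, z) *
         (condZ M V u z / mixZ M PU V z) * (mixY M PU V s y / condY M V u s y)
       = PU u * (condZ M V u z / mixZ M PU V z) * (PS M s * mixY M PU V s y * Q y z)
         * (condY M V u s y / condY M V u s y).
      rewrite -mulr_suml -mulr_suml (_ : \sum_i _ = PU u * PS M s * Q y z * condY M V u s y).
        by ring.
      rewrite /condY mulr_sumr; apply: eq_bigr => x _; rewrite markov /P /=; ring.
    apply: ler_piMr.
      rewrite !(mulr_ge0, PS_ge0, invr_ge0) //; by case: (Q_pmf y).
    by have [->|c0] := eqVneq (condY M V u s y) 0; rewrite ?mul0r // mulfV.
  have mixQ z : \sum_s \sum_y PS M s * mixY M PU V s y * Q y z = mixZ M PU V z.
    rewrite -margZ_mix /margZ.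
    under [RHS]eq_bigr do rewrite -(jointZ_markov _ _ (fun x s y => markov x s y z)).
    rewrite [RHS]exchange_big; apply: eq_bigr => s _ /=.
    rewrite [RHS]exchange_big; apply: eq_bigr => y _ /=.
    rewrite /mixY mulr_sumr mulr_suml; apply: eq_bigr => u _.
    by rewrite jointY_cond; ring.
  rewrite -[leRHS](cloud_law_pmf M PU_pmf V_pmf).2 sum_pair.
  apply: ler_sum => u _; apply: ler_sum => z _; rewrite mixQ /cloud_law /=.
  rewrite -mulrA ler_wpM2l //.
  have [->|m0] := eqVneq (mixZ M PU V z) 0; first by rewrite mulr0.
  by rewrite divfK.
rewrite -subr_le0; have := gibbs (joint_pmf M PV_ge0 PV_pmf) r0 _ r1.
have -> : satellite_info + cloud_info - pair_info =
  \sum_o joint_law M P o * (ln (r o) - ln (joint_law M P o)).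
  rewrite /satellite_info /cloud_info /pair_info.
  rewrite -(sum_joint_input_output (fun u x s y => ln (outY M x s y) - ln (condY M V u s y))).
  rewrite -(sum_joint_input_output (fun u x s y => ln (outY M x s y) - ln (mixY M PU V s y))).
  rewrite -(sum_joint_cloud (fun u z => ln (condZ M V u z) - ln (mixZ M PU V z))).
  rewrite -big_split -sumrB /=; apply: eq_bigr => -[[[[s u] x] y] z] _.
  rewrite [rvU _]/= [rvX _]/= [rvS _]/= [rvY _]/= [rvZ _]/=.
  have [->|J0] := eqVneq (joint_law M P (s, u, x, y, z)) 0.
    by rewrite !mul0r addr0 subr0.
  have J : 0 < joint_law M P (s, u, x, y, z).
    by rewrite lt_neqAle eq_sym J0 joint_ge0 //; exact: PV_ge0.
  have [p1 p2 p3 p4 p5] := pos _ _ _ _ _ J.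
  rewrite -mulrDr -mulrBr; congr (_ * _).
  rewrite /r -[P (u, x) * _ * _]/(joint_law M P (s, u, x, y, z)).
  move: (joint_law M P _) J {J0} => J0 J.
  by rewrite !lnM ?lnV ?posrE ?mulr_gt0 ?invr_gt0 //; ring.
apply => -[[[[s u] x] y] z] J; have [p1 p2 p3 p4 p5] := pos _ _ _ _ _ J.
by rewrite /r mulr_gt0 ?divr_gt0 // mulr_gt0 ?divr_gt0.
Qed.

End Superposition.

(** * Achievability *)

Section Achievability.
Context {R : realType} {X S Y Z Shat : finType} (M : bistatic R X S Y Z Shat).
Context (Q : Y -> Z -> R) (Q_pmf : forall y, is_pmf (Q y)).
Hypothesis markov : forall x s y z, chan M (x, s) (y, z) = outY M x s y * Q y z.

Lemma aux_distortion_ge0 (U : finType) (P : U * X -> R) (h : U -> Z -> Shat) :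
  is_pmf P -> 0 <= aux_distortion M P h.
Proof.
move=> [P0 _]; apply: sumr_ge0 => o _; rewrite mulr_ge0 ?dist_ge0 //.
by apply: joint_ge0.
Qed.

(** Each threshold exponent lies [e] below the mean of its log-ratio, so each failure decays
    geometrically. The common base [rho] also dominates exp(-e), which will absorb the
    collisions. *)
Lemma failure_rates (U : finType) (PU : U -> R) (V : U -> X -> R) (e : R) :
  is_pmf PU -> (forall u, is_pmf (V u)) -> 0 < e ->
  exists2 rho : R, 0 < rho < 1 & forall n,
    [/\ satellite_failure (block_channel M n) (@block_PU R U PU n) (@block_V R X U V n)
          (expR (n%:R * (satellite_info M PU V - e))) <= rho ^+ n,
        pair_failure (block_channel M n) (@block_PU R U PU n) (@block_V R X U V n)
          (expR (n%:R * (pair_info M PU V - e))) <= rho ^+ n,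
        cloud_failure (block_channel M n) (@block_PU R U PU n) (@block_V R X U V n)
          (expR (n%:R * (cloud_info M PU V - e))) <= rho ^+ n &
        expR (- (n%:R * e)) <= rho ^+ n].
Proof.
move=> PU_pmf V_pmf e0.
have PU0 u : 0 <= PU u by case: PU_pmf.
have V0 u x : 0 <= V u x by case: (V_pmf u).
have pos u x s y : 0 < input_output_law M PU V (u, (x, (s, y))) ->
  [/\ 0 < outY M x s y, 0 < condY M V u s y & 0 < mixY M PU V s y].
  rewrite /input_output_law /=.
  move=> /mulr_gt0_split[]; rewrite ?mulr_ge0 ?PS_ge0 ?outY_ge0 // => u0.
  move=> /mulr_gt0_split[]; rewrite ?mulr_ge0 ?PS_ge0 ?outY_ge0 // => v0.
  move=> /mulr_gt0_split[]; rewrite ?mulr_ge0 ?PS_ge0 ?outY_ge0 // => _ y0.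
  have c0 : 0 < condY M V u s y.
    by apply: (sum_gt0 (a := x)) => [x'|]; rewrite ?mulr_ge0 ?outY_ge0 // mulr_gt0.
  split=> //; apply: (sum_gt0 (a := u)) => [u'|]; last by rewrite mulr_gt0.
  by rewrite mulr_ge0 // condY_ge0.
have lt_e x : x - e < x :> R by rewrite ltrBlDr ltrDl.
have [r2 r2P H2] := @likelihood_failure R _ (input_output_law M PU V)
  (fun o => outY M o.2.1 o.2.2.1 o.2.2.2) (fun o => condY M V o.1 o.2.2.1 o.2.2.2)
  (satellite_info M PU V - e) (input_output_pmf M PU_pmf V_pmf)
  (fun o => let: (u, (x, (s, y))) := o in fun p => let: And3 a b _ := pos u x s y p in conj a b)
  (lt_e _).
have [r3 r3P H3] := @likelihood_failure R _ (input_output_law M PU V)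
  (fun o => outY M o.2.1 o.2.2.1 o.2.2.2) (fun o => mixY M PU V o.2.2.1 o.2.2.2)
  (pair_info M PU V - e) (input_output_pmf M PU_pmf V_pmf)
  (fun o => let: (u, (x, (s, y))) := o in fun p => let: And3 a _ b := pos u x s y p in conj a b)
  (lt_e _).
have cpos o : 0 < cloud_law M PU V o ->
    0 < condZ M V o.1 o.2 /\ 0 < mixZ M PU V o.2.
  case: o => u z; rewrite /cloud_law /=.
  move=> /mulr_gt0_split[]; rewrite ?condZ_ge0 // => u0 c0; split=> //.
  apply: (sum_gt0 (a := u)) => [u'|]; last by rewrite mulr_gt0.
  by rewrite mulr_ge0 // condZ_ge0.
have [r1 r1P H1] := @likelihood_failure R _ (cloud_law M PU V)
  (fun o => condZ M V o.1 o.2) (fun o => mixZ M PU V o.2) (cloud_info M PU V - e)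
  (cloud_law_pmf M PU_pmf V_pmf) cpos (lt_e _).
pose rho := Num.max (Num.max r1 r2) (Num.max r3 (expR (- e))).
move/andP: r1P => [r10 r11]; move/andP: r2P => [r20 r21]; move/andP: r3P => [r30 r31].
have le n r : 0 < r -> r <= rho -> r ^+ n <= rho ^+ n.
  by move=> r0 rr; rewrite lerXn2r ?nnegrE ?(ltW r0) // (le_trans (ltW r0)).
exists rho.
  rewrite /rho !lt_max r10 /= !gt_max r11 r21 r31 /= -expR0 ltr_expR oppr_lt0.
  exact: e0.
move=> n; split.
- rewrite block_satellite_failure; apply: le_trans (H2 n) (le n _ r20 _).
  by rewrite /rho !le_max lexx orbT.
- rewrite block_pair_failure; apply: le_trans (H3 n) (le n _ r30 _).
  by rewrite /rho !le_max lexx !orbT.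
- rewrite block_cloud_failure; apply: le_trans (H1 n) (le n _ r10 _).
  by rewrite /rho !le_max lexx.
- rewrite -mulrN expRM_natl; apply: le (expR_gt0 _) _.
  by rewrite /rho !le_max lexx !orbT.
Qed.

Lemma superposition_codes (U : finType) (P : U * X -> R) (h : U -> Z -> Shat)
    (x0 : X) (r : R) : is_pmf P -> r < aux_rate M P ->
  exists sigma K : R, [/\ 0 < sigma < 1, 0 <= K & forall n,
    exists c : Defs.code X S Y Z Shat (msg_card r n) n,
      distortion M c <= aux_distortion M P h + K * sigma ^+ n /\
      error_prob M c <= (aux_distortion M P h + K) * sigma ^+ n].
Proof.
move=> Ppmf rP.
have D0 := aux_distortion_ge0 h Ppmf.
have [PU [V [PU_pmf V_pmf PE]]] := disintegration x0 Ppmf.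
set D := aux_distortion M P h in D0 *.
have DE : D = mean_cost M PU V (fun s u z => dist M s (h u z)).
  by rewrite mean_cost_distortion // -PE.
pose I1 := cloud_info M PU V; pose I2 := satellite_info M PU V; pose I3 := pair_info M PU V.
have I3_ge : I2 + I1 <= I3 by apply: info_le.
(* A quarter of the gap: the rates of clouds and of satellites lie [2 * e] below their informations,
   the thresholds [e] below, which leaves a factor exp(-ne) for collisions. *)
pose e := (I2 + I1 - r * ln 2) / 4.
have e0 : 0 < e.
  rewrite divr_gt0 // subr_gt0 -aux_rate_split // -PE.
  by rewrite ltr_pM2r ?ln2_gt0.
have rE : r * ln 2 = (I1 - 2 * e) + (I2 - 2 * e) by rewrite /e; field.
have [rho /andP[rho0 rho1] Hrho] := failure_rates PU_pmf V_pmf e0.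
(* Half of the exponent pays for the weight [sigma ^- n] that will be put on the error. *)
pose sigma := Num.sqrt rho.
have sigma0 : 0 < sigma by rewrite sqrtr_gt0.
have sigma1 : sigma < 1 by rewrite -[ltRHS]sqrtr1 ltr_sqrt.
have sigmaE n : rho ^+ n = sigma ^+ n * sigma ^+ n.
  by rewrite -exprMn -expr2 sqr_sqrtr // ltW.
pose dmax := \sum_s \sum_t dist M s t.
have dmax0 : 0 <= dmax by do 2 (apply: sumr_ge0 => ? _); exact: dist_ge0.
have distle s t : dist M s t <= dmax.
  rewrite /dmax (bigD1 s) //= (bigD1 t) //= -addrA lerDl addr_ge0 ?sumr_ge0 // => *.
    exact: dist_ge0.
  by rewrite sumr_ge0 // => *; exact: dist_ge0.
(* The 4 counts the error terms, two failures and two collisions; the 2 counts cloud failure and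
   cloud collisions, each costing up to [dmax]. *)
exists sigma, (4 + 2 * dmax); split; [by rewrite sigma0|by rewrite addr_ge0 ?mulr_ge0|].
move=> n; have [F2 F3 F1 Fe] := Hrho n.
pose c1 := expR (n%:R * (I1 - 2 * e)); pose c2 := expR (n%:R * (I2 - 2 * e)).
pose c3 := expR (n%:R * (r * ln 2)).
have tr (c : R) : 0 <= c -> (Num.truncn c)%:R <= c < (Num.truncn c).+1%:R.
  exact: truncn_itv.
have /andP[k1 k1'] := tr c1 (expR_ge0 _); have /andP[k2 k2'] := tr c2 (expR_ge0 _).
have [|cloud cloudP] := @cloud_partition (msg_card r n) (Num.truncn c1) (Num.truncn c2).
  apply: msg_card_le; rewrite rE mulrDr expRD natrM.
  by apply: ler_pM; rewrite ?expR_ge0 ?ltW.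
pose w0 : 'I_(msg_card r n) := Ordinal (msg_card_gt0 r n).
pose kap := block_cost (n := n) (fun s u z => dist M s (h u z)).
have kap0 s u z : 0 <= kap s u z.
  by rewrite mulr_ge0 ?invr_ge0 ?sumr_ge0 // => i _; exact: dist_ge0.
have kapm s u z : kap s u z <= dmax.
  have le : \sum_i dist M (s i) (h (u i) (z i)) <= n%:R * dmax.
    apply: (@le_trans _ _ (\sum_(i < n) dmax)); first by apply: ler_sum => i _.
    by rewrite sumr_const card_ord -[leLHS]mulr_natl.
  apply: le_trans (ler_wpM2l _ le) _; first by rewrite invr_ge0.
  have [n0|n0] := eqVneq (n%:R : R) 0; first by rewrite n0 invr0 mul0r.
  by rewrite mulKf.
have [|w||cb] := @good_codebook R _ _ _ _ _ (block_channel M n) _ _ _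
  (block_PU_pmf n PU_pmf) (block_V_pmf V_pmf)
  (expR (n%:R * (I1 - e))) (expR (n%:R * (I2 - e))) (expR (n%:R * (I3 - e)))
  (expR_gt0 _) (expR_gt0 _) (expR_gt0 _) _ _ cloud ord0 w0 c1 c2 c3 _ _ (msg_card_lt r n)
  kap dmax dmax0 kap0 kapm (sigma ^- n).
- by rewrite -natr1 addrK.
- by apply: le_trans k2; rewrite ler_nat.
- by rewrite invr_ge0 exprn_ge0 // ltW.
have errE := error_code_of M PU V (expR (n%:R * (I1 - e))) (expR (n%:R * (I2 - e)))
  (expR (n%:R * (I3 - e))) cloud ord0 w0 h cb.
have distE := distortion_code_of M PU V (expR (n%:R * (I1 - e))) (expR (n%:R * (I2 - e)))
  (expR (n%:R * (I3 - e))) cloud ord0 w0 h cb.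
rewrite -errE -distE.
set c := code_of _ _ _ _ _ _ _ _ _ _ _ => good.
have mean_le : mean_cost (block_channel M n) (block_PU PU (n:=n)) (block_V V (n:=n)) kap <= D.
  (* For the empty block the cost is 0, and [D] is nonnegative. *)
  have [n0|n0] := posnP n; last by rewrite block_mean_cost // -DE.
  have nz : n%:R^-1 = 0 :> R by rewrite n0 invr0.
  suff -> : mean_cost (block_channel M n) (block_PU PU (n:=n)) (block_V V (n:=n)) kap = 0 by [].
  rewrite /mean_cost big1 // => u _; rewrite big1 ?mulr0 // => x _.
  rewrite big1 ?mulr0 // => s _; rewrite big1 // => y _; rewrite big1 // => z _.
  by rewrite /kap /block_cost nz mul0r mulr0.
have ratio (a b : R) : b <= a - e -> expR (n%:R * b) / expR (n%:R * a) <= rho ^+ n.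
  move=> ba; rewrite -expRN -expRD; apply: le_trans Fe; rewrite ler_expR.
  by rewrite -mulrN -mulrDr -mulrN ler_wpM2l ?ler0n //; lra.
have {}good : sigma ^- n * error_prob M c + distortion M c <= D + (4 + 2 * dmax) * sigma ^+ n.
  apply: le_trans good _.
  have R1 : c1 / expR (n%:R * (I1 - e)) <= rho ^+ n by apply: ratio; lra.
  have R2 : c2 / expR (n%:R * (I2 - e)) <= rho ^+ n by apply: ratio; lra.
  have R3 : c3 / expR (n%:R * (I3 - e)) <= rho ^+ n by apply: ratio; lra.
  have sn0 : 0 < sigma ^+ n by rewrite exprn_gt0.
  have sn1 : sigma ^+ n <= 1 by rewrite exprn_ile1 // ltW.
  have H4 : sigma ^- n * (satellite_failure (block_channel M n) (block_PU PU (n:=n))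
      (block_V V (n:=n)) (expR (n%:R * (I2 - e)))
    + pair_failure (block_channel M n) (block_PU PU (n:=n)) (block_V V (n:=n))
      (expR (n%:R * (I3 - e)))
    + (c2 / expR (n%:R * (I2 - e)) + c3 / expR (n%:R * (I3 - e)))) <= 4 * sigma ^+ n.
    rewrite ler_pdivrMl // mulrCA -sigmaE; lra.
  have H2' : dmax * (cloud_failure (block_channel M n) (block_PU PU (n:=n))
      (block_V V (n:=n)) (expR (n%:R * (I1 - e)))
    + c1 / expR (n%:R * (I1 - e))) <= dmax * (2 * sigma ^+ n).
    apply: ler_wpM2l => //.
    have : rho ^+ n <= sigma ^+ n by rewrite sigmaE ler_piMl // ltW.
    lra.
  by move: H4 H2' mean_le; lra.
have dist0 : 0 <= distortion M c.
  rewrite mulr_ge0 ?invr_ge0 ?sumr_ge0 // => i _; apply: sumr_ge0 => -[[[w s] y] z] _.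
  by rewrite mulr_ge0 ?dist_ge0 ?block_law_ge0.
have err0 : 0 <= error_prob M c.
  by apply: sumr_ge0 => o _; exact: block_law_ge0.
have sn0 : 0 < sigma ^+ n by rewrite exprn_gt0.
have sn1 : sigma ^+ n <= 1 by rewrite exprn_ile1 // ltW.
exists c; split.
  by apply: le_trans good; rewrite lerDr mulr_ge0 // invr_ge0 ltW.
rewrite mulrC -ler_pdivrMl //.
have : (4 + 2 * dmax) * sigma ^+ n <= 4 + 2 * dmax.
  by rewrite ler_piMr // addr_ge0 ?mulr_ge0.
by move: good dist0; lra.
Qed.

End Achievability.

(** * The capacity-distortion function *)

Section Limsup.
Context {R : realType}.
Local Open Scope classical_set_scope.

Lemma limn_esup_le (u : nat -> R) (D : R) :
  (limn_esup (fun n => (u n)%:E) <= D%:E)%E <->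
  forall e, 0 < e -> \forall n \near \oo, u n <= D + e.
Proof.
split=> [uD e e0|H].
  have : (limn_esup (fun n => (u n)%:E) < (D + e)%:E)%E.
    by apply: le_lt_trans uD _; rewrite lte_fin ltrDl.
  move=> /ereal_inf_ltP[_ [A oA <-] lt].
  apply: filterS oA => n An.
  rewrite -lee_fin; apply: le_trans (ltW lt); apply: ereal_sup_ubound.
  by exists n.
apply/lee_addgt0Pr => e e0.
apply: (@le_trans _ _ (ereal_sup ((fun n => (u n)%:E) @` [set n | u n <= D + e]))).
  by apply: ereal_inf_lbound; exists [set n | u n <= D + e] => //; exact: H.
by apply/ereal_supP => _ [n /= un <-]; rewrite -EFinD lee_fin.
Qed.

End Limsup.

Section CapacityBounds.
Context {R : realType} {X S Y Z Shat : finType} (M : bistatic R X S Y Z Shat).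
Context (Q : Y -> Z -> R) (Q_pmf : forall y, is_pmf (Q y)).
Hypothesis markov : forall x s y z, chan M (x, s) (y, z) = outY M x s y * Q y z.

(** The excess distortion is geometric in n and disappears in the limit superior. *)
Lemma superposition_achievable (U : finType) (P : U * X -> R) (h : U -> Z -> Shat)
    (x0 : X) (r D : R) : is_pmf P -> aux_distortion M P h <= D ->
  r < aux_rate M P -> achievable M r D.
Proof.
move=> Ppmf PD rP.
have [sigma [K [/andP[sigma0 sigma1] K0 H]]] :=
  superposition_codes Q_pmf markov h x0 Ppmf rP.
exists (fun n => sval (cid (H n))).
have geo (a : R) : (a * sigma ^+ n @[n --> \oo] --> (0 : R))%classic.
  by apply: (@cvg_geometric R a sigma); rewrite gtr0_norm.
split.
  apply: (squeeze_cvgr (f := fun=> 0) _ (cvg_cst _) (geo (aux_distortion M P h + K))).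
  near=> n; case: cid => c /= [_ ->]; rewrite andbT.
  by apply: sumr_ge0 => o _; exact: block_law_ge0.
apply/limn_esup_le => e e0; near=> n; case: cid => c /= [cD _].
apply: le_trans cD _; apply: lerD => //; near: n.
have /cvgrPdist_lt/(_ e e0) := geo K.
by apply: filterS => n; rewrite sub0r normrN => /ltW; apply: le_trans (ler_norm _).
Unshelve. all: by end_near.
Qed.

(** The cost is linear in P_X, so a single input letter is optimal; only finitely many pairs of a
    letter and an estimator remain. *)
Lemma Dmin_attained (D : R) : (0 < #|X|)%N -> (0 < #|Shat|)%N -> Dmin M <= D ->
  exists (x : X) (h : Z -> Shat),
    \sum_s \sum_y \sum_z PS M s * chan M (x, s) (y, z) * dist M s (h z) <= D.
Proof.
move=> /card_gt0P[x0 _] /card_gt0P[t0 _] DminD.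
pose cost (xh : X * {ffun Z -> Shat}) :=
  \sum_s \sum_y \sum_z PS M s * chan M (xh.1, s) (y, z) * dist M s (xh.2 z).
case: (@Order.TotalTheory.arg_minP _ _ _ (x0, [ffun=> t0]) xpredT cost isT) => xh _ xhmin.
exists xh.1, (fun z => xh.2 z); apply: le_trans DminD.
apply: lb_le_inf.
  pose PX (x : X) : R := (x == x0)%:R.
  have PXpmf : is_pmf PX.
    split=> [x|]; first by rewrite ler0n.
    by under eq_bigr do rewrite -[PX _]mulr1; rewrite (sum_delta _ (fun=> 1)).
  by eexists; exists PX, (fun=> t0); split; [exact: PXpmf|].
move=> _ [PX [h [[PX0 PX1] ->]]].
rewrite /expect.
have -> : \sum_t (let '(x, s, y, z) := t in PX x * PS M s * chan M (x, s) (y, z)) *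
    (let '(_, s, _, z) := t in dist M s (h z))
  = \sum_x PX x * cost (x, [ffun z => h z]).
  rewrite !sum_pair; apply: eq_bigr => x _; rewrite mulr_sumr.
  apply: eq_bigr => s _; rewrite mulr_sumr; apply: eq_bigr => y _.
  rewrite mulr_sumr; apply: eq_bigr => z _; by rewrite /= ffunE !mulrA.
rewrite -[leLHS]mul1r -PX1 mulr_suml; apply: ler_sum => x _.
by apply: ler_wpM2l => //; exact: xhmin.
Qed.

(** One message, a constant input and a letterwise estimator. It provides a feasible point for the
    maximum and keeps the set of achievable rates nonempty. *)
Lemma zero_rate_achievable (D : R) : (0 < #|X|)%N -> (0 < #|Shat|)%N ->
  Dmin M <= D -> achievable M 0 D.
Proof.
move=> X0 T0 /(Dmin_attained X0 T0)[x [h costD]].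
have D0 : 0 <= D.
  apply: le_trans costD; do 3 (apply: sumr_ge0 => ? _).
  by rewrite !mulr_ge0 ?PS_ge0 ?chan_ge0 ?dist_ge0.
have one n : (msg_card (0 : R) n <= 1)%N.
  by apply: msg_card_le; rewrite mul0r mulr0 expR0.
pose w0 n : 'I_(msg_card (0 : R) n) := Ordinal (msg_card_gt0 0 n).
pose c n : Defs.code X S Y Z Shat (msg_card (0 : R) n) n :=
  Code (fun _ => [ffun=> x]) (fun _ _ => w0 n) (fun z => [ffun i => h (z i)]).
exists c; split.
  rewrite (_ : (fun n => error_prob M (c n)) = fun=> 0); first exact: cvg_cst.
  apply/funext => n; apply: big1 => -[[[w s] y] z] /eqP[].
  apply: val_inj => /=; have := leq_trans (ltn_ord w) (one n).
  by case: (nat_of_ord w).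
apply/limn_esup_le => e e0; apply: nearW => n; apply: (@le_trans _ _ D); last by rewrite lerDl ltW.
have [n0|n0] := posnP n.
  suff -> : distortion M (c n) = 0 by [].
  by rewrite /distortion (_ : n%:R = 0) ?invr0 ?mul0r // n0.
have m0 := msg_card_gt0 (0 : R) n.
(* The distortion is read off the converse law of the code, which charges only the input [x]. *)
pose P := converse_law M (c n).
have -> : distortion M (c n) = aux_distortion M P (fun _ z => h z).
  rewrite /aux_distortion /expect (sum_converse_law M (c n)
    (fun o => dist M (rvS o) (h (rvZ o)))).
  congr (_ * _); apply: eq_bigr => i _; apply: eq_bigr => -[[[w s] y] z] _.
  by rewrite /= ffunE.
have [P0 P1] := converse_law_pmf M (c n) m0 n0.
rewrite aux_distortion_cost; apply: le_trans costD.
set cost := (leRHS); rewrite -[leRHS]mul1r -P1 sum_pair mulr_suml.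
apply: ler_sum => -[i v] _; rewrite mulr_suml; apply: ler_sum => x' _.
have [->|x'x] := eqVneq x' x; first by [].
rewrite -/P; suff -> : P ((i, v), x') = 0 by rewrite !mul0r.
rewrite /P /= big1 ?mulr0 // => w _; rewrite ffunE.
by rewrite (negbTE x'x) mulr0 mul0r.
Qed.

(** At block length n the slack in rate is 1/n plus r times the error probability. The alphabet
    depends on n, so it is reduced to |X| + 1 letters for each n before the limit. *)
Lemma achievable_bound (r D : R) : 0 <= r -> achievable M r D ->
  exists (P : 'I_(#|X| + 1) * X -> R) h,
    [/\ is_pmf P, aux_distortion M P h <= D & r <= aux_rate M P].
Proof.
move=> r0 [c [err0 distD]]; apply: rate_limit => e e0.
have r1 : 0 < r + 1 by lra.
(* Divided by [r + 1] because [r] may be 0. *)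
have e1 : 0 < e / 2 / (r + 1) by do 2 apply: divr_gt0 => //.
have [n [n0 ne en dn]] : exists n : nat, [/\ (0 < n)%N, n%:R^-1 <= e / 2,
    error_prob M (c n) * r <= e / 2 & distortion M (c n) <= D + e].
  apply: (@filter_ex _ \oo%classic); near=> n; split.
  - by near: n; exists 1%N.
  - near: n; exists (Num.truncn (e / 2)^-1).+1 => // n /= tn.
    rewrite -[leRHS]invrK lef_pV2 ?posrE ?invr_gt0 ?divr_gt0 ?ltr0n ?(leq_trans _ tn) //.
    apply: le_trans (ltW (truncnS_gt _)) _; by rewrite ler_nat.
  - apply: (@le_trans _ _ (error_prob M (c n) * (r + 1))).
      by apply: ler_wpM2l; [apply: sumr_ge0 => o _; exact: block_law_ge0|lra].
    rewrite -ler_pdivlMr //; near: n.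
    have /cvgrPdist_lt/(_ _ e1) := err0.
    by apply: filterS => n; rewrite sub0r normrN => /ltW; apply: le_trans (ler_norm _).
  - by near: n; move/limn_esup_le : distD; exact.
have m0 := msg_card_gt0 r n.
have P_pmf := converse_law_pmf M (c n) m0 n0.
have [P' [h' [P'pmf P'D P'r]]] := cardinality_bound M (converse_estimator (c n)) P_pmf.
exists P', h'; split=> //; first by rewrite P'D converse_distortion.
apply: le_trans P'r.
have rate := converse_rate (c n) m0 n0 Q_pmf markov.
have err1 : error_prob M (c n) <= 1.
  have [p0 <-] := block_law_pmf M (c n) m0.
  rewrite /error_prob /prob big_mkcond; apply: ler_sum => o _.
  by case: ifP.
have lnm : n%:R * (r * ln 2) <= ln (msg_card r n)%:R.
  by rewrite -[leLHS]expRK ler_ln ?posrE ?expR_gt0 ?ltr0n // msg_card_ge.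
have n1 : 0 < n%:R :> R by rewrite ltr0n.
have l2 := @ln2_gt0 R.
have : (1 - error_prob M (c n)) * (n%:R * (r * ln 2)) - ln 2
    <= n%:R * (aux_rate M (converse_law M (c n)) * ln 2).
  apply: le_trans rate; rewrite lerD2r ler_wpM2l //; lra.
have -> : (1 - error_prob M (c n)) * (n%:R * (r * ln 2)) - ln 2
   = n%:R * (((1 - error_prob M (c n)) * r - n%:R^-1) * ln 2).
  by field; rewrite gt_eqF.
rewrite ler_pM2l // ler_pM2r // => H.
by apply: le_trans H; lra.
Unshelve. all: by end_near.
Qed.

End CapacityBounds.

Theorem theorem6 (R : realType) (X S Y Z Shat : finType)
    (M : bistatic R X S Y Z Shat)
    (X_nonempty : (0 < #|X|)%N) (Shat_nonempty : (0 < #|Shat|)%N)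
    (markov : markov_XS_Y_Z M)
    (hstar : forall U : finType, (U * X -> R) -> U -> Z -> Shat)
    (hstar_argmin : forall (U : finType) (P : U * X -> R),
       is_pmf P -> is_argmin_estimator M P (hstar U P))
    (D : R) (hD : Dmin M <= D) :
  exists2 c : R,
    is_maximum (aux_rates M hstar D) c & capacity_distortion M D = c%:E.
Proof.
have [Q [Q_pmf Qmarkov]] := markov.
have markov' x s y z : chan M (x, s) (y, z) = outY M x s y * Q y z by exact: Qmarkov.
have zero := zero_rate_achievable X_nonempty Shat_nonempty hD.
(* The converse applied to the zero-rate codes provides a feasible pair. *)
have [|P [h [Ppmf PD Pmax]]] := @exists_best R X S Y Z Shat M 'I_(#|X| + 1) D.
  have [P0 [h0 [P0pmf P0D _]]] := achievable_bound Q_pmf markov' (lexx 0) zero.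
  by exists P0, h0.
have /card_gt0P[x0 _] := X_nonempty.
exists (aux_rate M P).
  split.
    exists 'I_(#|X| + 1), P; split=> //; first by rewrite card_ord.
    (* [hstar] does no worse than [h], so [P] meets the constraint with [hstar] as well. *)
    apply: le_trans PD; apply: argmin_estimator_le (hstar_argmin _ _ Ppmf).
    by case: Ppmf.
  move=> _ [U [P' [_ P'pmf P'D ->]]].
  have [P2 [h2 [P2pmf P2D P2r]]] := cardinality_bound M (hstar U P') P'pmf.
  by apply: le_trans P2r _; apply: (Pmax P2 h2) => //; rewrite P2D.
apply/eqP; rewrite eq_le; apply/andP; split.
  apply/ereal_supP => _ [r [r0 rD] <-]; rewrite lee_fin.
  have [P2 [h2 [P2pmf P2D P2r]]] := achievable_bound Q_pmf markov' r0 rD.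
  exact: le_trans P2r (Pmax P2 h2 P2pmf P2D).
apply/lee_subgt0Pr => e e0; rewrite -EFinB.
(* Admissible rates are nonnegative; a target at or below 0 is covered by the rate 0. *)
have [r0|r0] := leP (aux_rate M P - e) 0.
  apply: (@le_trans _ _ 0%:E); first by rewrite lee_fin.
  by apply: ereal_sup_ubound; exists 0.
apply: ereal_sup_ubound; exists (aux_rate M P - e) => //; split; first exact: ltW.
apply: (superposition_achievable (P := P) (h := h) Q_pmf markov' x0) => //.
by rewrite ltrBlDr ltrDl.
Qed.
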